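(* Let $u_1$ be a smooth radially symmetric function on $\mathbb{R}^2$ such that $$\Delta u_1+e^{2u_1}\le 0\quad\text{in }\mathbb{R}^2 .$$ Let $u_2$ be another smooth radially symmetric function defined in $\mathbb{R}^2$. If for some disk $B_r$ we have $$\Delta u_2+e^{2u_2}\ge\Delta u_1+e^{2u_1}\ \text{ in }B_r,\qquad u_2>u_1\ \text{ in }B_r,\qquad u_2=u_1\ \text{ on }\partial B_r,$$ then $$\int_{B_r}e^{2u_1}\,dx+\int_{B_r}e^{2u_2}\,dx\ge\int_{\mathbb{R}^2}e^{2u_1}\,dx .$$ The equality holds if and only if $(B_r,e^{2u_1}\delta)$ and $(B_r,e^{2u_2}\delta)$ are two complementary spherical caps on the unit sphere.
   Context: $\delta$ is the Euclidean metric on $\mathbb{R}^2$ and $B_r$ is the disk of radius $r>0$ centered at the origin; radially symmetric means radially symmetric about the origin. A spherical cap is a geodesic disk in the unit sphere $S^2$; ''two complementary spherical caps'' means that the two Riemannian surfaces are isometric, respectively, to a spherical cap in $S^2$ and to its complementary cap (the two caps together making up $S^2$ up to their common boundary circle).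
   Formalization: Equality is characterized by the two disks being complementary spherical caps together with Δu_1+e^{2u_1}=0 outside B_r; the caps condition alone is not sufficient, since it does not constrain u_1 outside B_r. *)

(* Defs.v *)
From HB Require Import structures.
From mathcomp Require Import all_boot all_order all_algebra.
From mathcomp Require Import all_classical all_reals all_analysis.

Set Implicit Arguments.
Unset Strict Implicit.
Unset Printing Implicit Defensive.

Import Order.TTheory GRing.Theory Num.Theory.
Import numFieldNormedType.Exports.

Local Open Scope classical_set_scope.
Local Open Scope ring_scope.

Section Plane.
Context {R : realType}.

(* The norm of the library on R * R is the sup norm, hence the explicit
   Euclidean inner product; both norms induce the same topology. *)
Definition dot2 (v w : R * R) : R := v.1 * w.1 + v.2 * w.2.

Definition disk (r : R) : set (R * R) := [set x | dot2 x x < r ^+ 2].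

Definition circle (r : R) : set (R * R) := [set x | dot2 x x = r ^+ 2].

Definition radial (u : R * R -> R) : Prop :=
  forall x y, dot2 x x = dot2 y y -> u x = u y.

Definition e1 : R * R := (1, 0).
Definition e2 : R * R := (0, 1).

Definition laplacian (u : R * R -> R) (x : R * R) : R :=
  'D_e1 ('D_e1 u) x + 'D_e2 ('D_e2 u) x.

(* Only meant for D open: the partial derivatives at a point of D then depend
   only on the restriction of f to D. *)
Fixpoint Ck_on (V : normedModType R) (k : nat) (D : set (R * R))
    (f : R * R -> V) : Prop :=
  (forall x, D x -> {for x, continuous f}) /\
  if k is k'.+1 then
    [/\ forall x, D x -> derivable f x e1 /\ derivable f x e2,
        Ck_on k' D ('D_e1 f) & Ck_on k' D ('D_e2 f)]
  else True.

Definition smooth_on (V : normedModType R) (D : set (R * R))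
    (f : R * R -> V) : Prop :=
  forall k, Ck_on k D f.

(* Area of D for the metric e^{2u} delta. *)
Definition area (D : set (R * R)) (u : R * R -> R) : \bar R :=
  (\int[(@lebesgue_measure R \x @lebesgue_measure R)%E]_(x in D)
     (expR (2 * u x))%:E)%E.

Definition dot3 (p q : 'rV[R]_3) : R := \sum_i p 0 i * q 0 i.

Definition unit_sphere : set 'rV[R]_3 := [set p | dot3 p p = 1].

(* acos (dot3 p q) is the geodesic distance between p and q in the unit
   sphere. *)
Definition geodesic_disk (p : 'rV[R]_3) (t : R) : set 'rV[R]_3 :=
  [set q | unit_sphere q /\ acos (dot3 p q) < t].

(* Geodesic disks about antipodal centers whose radii add up to pi: they are
   disjoint and cover the sphere up to their common boundary circle. *)
Definition complementary_caps (C1 C2 : set 'rV[R]_3) : Prop :=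
  exists p t, [/\ unit_sphere p, 0 < t < pi,
    C1 = geodesic_disk p t & C2 = geodesic_disk (- p) (pi - t)].

(* (D, e^{2u} delta), D open, is isometric to the open subset C of the unit
   sphere with the round metric. The inverse of phi need not be required to be
   smooth: it is, by the inverse function theorem, since the differential of
   phi is injective. *)
Definition isometric_to (D : set (R * R)) (u : R * R -> R)
    (C : set 'rV[R]_3) : Prop :=
  exists phi : R * R -> 'rV[R]_3,
    [/\ smooth_on D phi, set_bij D C phi &
        forall x, D x -> forall v w : R * R,
          dot3 ('D_v phi x) ('D_w phi x) = expR (2 * u x) * dot2 v w].

Definition isometric_to_complementary_caps (D : set (R * R))
    (u1 u2 : R * R -> R) : Prop :=
  exists C1 C2, [/\ complementary_caps C1 C2,
    isometric_to D u1 C1 & isometric_to D u2 C2].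

End Plane.

(* Main.v *)
Require Import Defs.
From mathcomp Require Import all_boot all_order all_algebra.
From mathcomp Require Import all_classical all_reals all_analysis.
From mathcomp Require Import measurable_realfun.
From mathcomp Require Import ring lra.
Import Order.TTheory GRing.Theory Num.Theory.
Import numFieldNormedType.Exports.

Set Implicit Arguments.
Unset Strict Implicit.
Unset Printing Implicit Defensive.

Local Open Scope classical_set_scope.
Local Open Scope ring_scope.

(** Everything is rotationally symmetric, so the statement is one about four
functions of the radius s: the profiles f and g of u1 and u2, and the areas
mu and nu of the disks of radius s, divided by twice the Euclidean area of the
unit disk, so that mu' = s e^{2f} and nu' = s e^{2g}.  Put p = s^2 e^{2f} (the
squared length of the circle of radius s, up to a factor), F = s f', and
likewise q, G for u2.  Then p' = 2 (1 + F) mu', and since s (Delta u + e^{2u})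
is the derivative of F + mu, the differential inequalities say that F + mu
decreases and that the gap (G + nu) - (F + mu) increases, from 0 at s = 0, up
to the radius r.

Outside the disk, let c = 1 + F(r), P = p(r) and n = mu - mu(r).  As F + n
decreases, P + 2 c n - n^2 - p increases from 0, so n^2 - 2 c n - P < 0: the
exterior area is less than every y > 0 with y^2 - 2 c y - P >= 0
(outer_bound).  It remains to see that y = nu(r) is such a number; this excess
is what inner_bound is about.

Let delta = nu - mu > 0.  The function V = q - p - 2 (1 + F) delta + delta^2
vanishes at 0 and V' = 2 nu' gap + 2 eta delta, where eta = - (F + mu)' >= 0;
the function W = p - 2 (1 + F) mu - mu^2 measures how far the first metric is
from a round one and W' = 2 eta mu.  At r one has q = p, and the excess is
(1 + 2 mu/delta) V - W.  With k = delta / (delta + 2 mu) taken at r, the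
derivative of Z = V - k W is 2 nu' gap + 2 eta (delta - k mu), which is
nonnegative as soon as delta >= k mu.  This may fail near the origin when
u2 - u1 is not monotone, but let s0 be the last radius with delta = k mu.
There the derivative of delta - k mu is nonnegative, that is q >= (1 + k) p,
and hence Z(s0) = q - (1 + k) p + delta^2 + k mu^2 >= k mu^2 >= 0.  From s0 on
Z increases, so Z(r) >= 0 (crossing_radius, inner_bound).

If equality holds in the theorem, all these inequalities are equalities: the
exterior computation gives F + mu constant for s > r, the interior one forces
mu(s0) = 0, so s0 = 0, and then eta = 0 and gap = 0 (outer_rigidity,
inner_rigidity).  Hence Delta u + e^{2u} = 0 for u1 in the plane and for u2 in
the disk.  Such a radial solution satisfies p = mu (2 - mu), which integrates
to e^{2f} = 4 k / (1 + k s^2)^2, and stereographic projection is an isometry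
onto a cap; p = q at r with mu(r) < nu(r) forces mu(r) + nu(r) = 2, which says
that the two caps are complementary.

Conversely, an isometry with an open part of the sphere gives
Delta u + e^{2u} = 0 in the disk (theorema_egregium), the remaining hypothesis
gives it for u1 outside, and then mu(r) + nu(r) = 2 is the limit of mu at
infinity. *)

(** * One-variable calculus *)

Section Calculus.
Context {R : realType}.
Implicit Types (f g : R -> R) (s a b : R).

(** The differentiation rules are restated for functions written with a bound
variable, so that they apply to explicit expressions by unification. *)
Lemma is_der_eq f s a b : is_derive s 1 f a -> a = b -> is_derive s 1 f b.
Proof. by move=> ? <-. Qed.

Lemma is_derD f g s a b : is_derive s 1 f a -> is_derive s 1 g b ->
  is_derive s 1 (fun t => f t + g t) (a + b).
Proof. exact: is_deriveD. Qed.

Lemma is_derB f g s a b : is_derive s 1 f a -> is_derive s 1 g b ->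
  is_derive s 1 (fun t => f t - g t) (a - b).
Proof. exact: is_deriveB. Qed.

Lemma is_derN f s a : is_derive s 1 f a -> is_derive s 1 (fun t => - f t) (- a).
Proof. exact: is_deriveN. Qed.

Lemma is_derM f g s a b : is_derive s 1 f a -> is_derive s 1 g b ->
  is_derive s 1 (fun t => f t * g t) (f s * b + g s * a).
Proof. exact: is_deriveM. Qed.

Lemma is_derC c s : is_derive s 1 (fun=> c : R) 0.
Proof. exact: is_derive_cst. Qed.

Lemma is_derI s : is_derive s 1 (fun t : R => t) 1.
Proof. exact: is_derive_id. Qed.

Lemma is_derX f n s a : is_derive s 1 f a ->
  is_derive s 1 (fun t => f t ^+ n) (n%:R * f s ^+ n.-1 * a).
Proof.
have -> : (fun t => f t ^+ n) = f ^+ n by apply/funext => t; rewrite exprfctE.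
exact: is_deriveX.
Qed.

Lemma is_derV f s a : f s != 0 -> is_derive s 1 f a ->
  is_derive s 1 (fun t => (f t)^-1) (- (f s ^- 2) * a).
Proof. exact: is_deriveV. Qed.

Lemma is_der_expR f s a : is_derive s 1 f a ->
  is_derive s 1 (fun t => expR (f t)) (expR (f s) * a).
Proof. move=> fa; exact: (@is_derive1_comp R expR f s (expR (f s)) a _ fa). Qed.

Lemma is_derive_continuous f (df : R -> R) :
  (forall s, is_derive s 1 f (df s)) -> continuous f.
Proof.
move=> fdf s; apply: differentiable_continuous; apply/derivable1_diffP.
by have := fdf s.
Qed.

Lemma MVT_on f (df : R -> R) a b : a < b ->
  (forall s, a <= s <= b -> is_derive s 1 f (df s)) ->
  exists c, [/\ a < c, c < b & f b - f a = df c * (b - a)].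
Proof.
move=> ab fdf.
have cf : {within `[a, b], continuous f}.
  apply: derivable_within_continuous => x; rewrite in_itv/= => /fdf dx.
  exact: ex_derive.
have dfo x : x \in `]a, b[%R -> is_derive x 1 f (df x).
  by rewrite in_itv/= => /andP[ax xb]; apply: fdf; rewrite !ltW.
have [c + e] := MVT ab dfo cf.
by rewrite in_itv/= => /andP[ac cb]; exists c.
Qed.

Lemma ge0_derive_le f (df : R -> R) a b : a <= b ->
  (forall s, is_derive s 1 f (df s)) ->
  (forall s, a < s < b -> 0 <= df s) -> f a <= f b.
Proof.
rewrite le_eqVlt => /predU1P[-> //|ab] fdf df0.
have [c [ac cb e]] := MVT_on ab (fun s _ => fdf s).
by rewrite -subr_ge0 e mulr_ge0 ?subr_ge0 ?(ltW ab)// df0// ac.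
Qed.

Lemma eq0_derive_eq_on f (df : R -> R) a b : a <= b ->
  (forall s, a <= s <= b -> is_derive s 1 f (df s)) ->
  (forall s, a < s < b -> df s = 0) -> f a = f b.
Proof.
rewrite le_eqVlt => /predU1P[-> //|ab] fdf df0.
have [c [ac cb e]] := MVT_on ab fdf.
by apply/eqP; rewrite eq_sym -subr_eq0 e df0 ?mul0r ?ac.
Qed.

Lemma eq0_derive_eq f (df : R -> R) a b : a <= b ->
  (forall s, is_derive s 1 f (df s)) ->
  (forall s, a < s < b -> df s = 0) -> f a = f b.
Proof. by move=> ab fdf; exact: (eq0_derive_eq_on ab (fun s _ => fdf s)). Qed.

Lemma gt0_derive_lt f (df : R -> R) a b : a < b ->
  (forall s, is_derive s 1 f (df s)) ->
  (forall s, a < s < b -> 0 < df s) -> f a < f b.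
Proof.
move=> ab fdf df0.
have [c [ac cb e]] := MVT_on ab (fun s _ => fdf s).
by rewrite -subr_gt0 e mulr_gt0 ?subr_gt0// df0// ac.
Qed.

Lemma is_derive_near_cst f s a c : is_derive s 1 f a ->
  (\forall t \near s, f t = c) -> a = 0.
Proof.
move=> fa fc; have [_ <-] := fa.
by rewrite (@near_eq_derive R R R f (cst c))// derive_cst.
Qed.

Lemma gt0_right_derive_ge0 f s a b : s < b -> is_derive s 1 f a ->
  (forall t, s < t < b -> f s <= f t) -> 0 <= a.
Proof.
move=> sb fa fs; have [df <-] := fa.
rewrite /derive cvg_at_rightE//.
apply: limr_ge.
  rewrite -(cvg_at_rightE (fun h : R => h^-1 *: ((f \o shift s) _ - f s)))//.
  apply: cvg_trans df; apply: cvg_app => A [e e0 Ae].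
  by exists e => // x xe x0; apply: Ae => //; exact/lt0r_neq0.
near=> h; rewrite [X in 0 <= X](_ : _ = h^-1 * (f (h * 1 + s) - f s))// mulr1.
have h0 : 0 < h by near: h; exact: nbhs_right_gt.
rewrite mulr_ge0 ?invr_ge0 ?(ltW h0)// subr_ge0 fs// ltrDr h0/= -ltrBrDr.
by near: h; apply: nbhs_right_lt; rewrite subr_gt0.
Unshelve. all: by end_near. Qed.

(** The point is the supremum of the set where f is nonpositive: f vanishes there
by continuity, and f cannot have a negative slope since it is positive just
after. *)
Lemma last_crossing f (df : R -> R) a b : a <= b ->
  (forall s, is_derive s 1 f (df s)) -> f a <= 0 -> 0 < f b ->
  exists s, [/\ a <= s < b, f s = 0, 0 <= df s & forall t, s < t <= b -> 0 < f t].
Proof.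
move=> ab fdf fa fb.
pose S := [set s | a <= s <= b /\ f s <= 0].
have Sa : S a by split=> //; rewrite lexx.
have supS : has_sup S.
  by split; [exists a|exists b => s [/andP[]]].
have cf := is_derive_continuous fdf.
have as0 : a <= sup S by exact: sup_upper_bound.
have s0b : sup S <= b by apply: sup_le_ub; [exists a|move=> s [/andP[]]].
have post t : sup S < t <= b -> 0 < f t.
  move=> /andP[st tb]; rewrite ltNge; apply/negP => ft.
  have : t <= sup S.
    by apply: sup_upper_bound => //; split; rewrite // tb (le_trans as0 (ltW st)).
  by rewrite leNgt st.
have fle : f (sup S) <= 0.
  rewrite leNgt; apply/negP => fs.
  have /nbhs_ballP[e /= e0 He] : \forall t \near sup S, 0 < f t.
    by have /(_ _ (lt_nbhsr fs)) := cf (sup S).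
  have [t [tab ft] et] := sup_adherent e0 supS.
  have ts : t <= sup S by exact: sup_upper_bound.
  have := He t; rewrite /ball/= ger0_norm ?subr_ge0// => /(_ _).
  by move=> H; move: (H ltac:(lra)); rewrite ltNge ft.
have s0b' : sup S < b.
  by rewrite lt_neqAle s0b andbT; apply/eqP => e; move: fb; rewrite -e ltNge fle.
have fge : 0 <= f (sup S).
  rewrite leNgt; apply/negP => fs.
  have /nbhs_ballP[e /= e0 He] : \forall t \near sup S, f t < 0.
    by have /(_ _ (lt_nbhsl fs)) := cf (sup S).
  pose t := Num.min b (sup S + e / 2).
  have st : sup S < t by rewrite lt_min s0b'/= ltrDl divr_gt0.
  have tb : t <= b by rewrite ge_min lexx.
  have te : t <= sup S + e / 2 by rewrite ge_min lexx orbT.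
  have := He t; rewrite /ball/= ltr0_norm ?subr_lt0// => H.
  have := post t; rewrite st tb => /(_ isT).
  by move=> ft; move: (H ltac:(lra)); rewrite ltNge (ltW ft).
have f0 : f (sup S) = 0 by apply/eqP; rewrite eq_le fle fge.
exists (sup S); split=> //; first by rewrite as0.
apply: (gt0_right_derive_ge0 s0b' (fdf _)) => t /andP[st tb].
by rewrite f0 ltW// post// st ltW.
Qed.

End Calculus.

(** Differentiates an explicit expression, leaving the comparison of the result with
the expected derivative. *)
Ltac der := eapply is_der_eq; [repeat first
  [ eassumption | eapply is_derD | eapply is_derB | eapply is_derN | eapply is_derM
  | eapply is_derX | eapply is_der_expR | eapply is_derC | eapply is_derI
  | match goal with H : forall s, is_derive s _ _ _ |- _ => eapply H end ] | ].

(** * Rotationally symmetric metrics: the inner disk *)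

Section Profiles.
Context {R : realType}.
Implicit Types (f g mu nu : R -> R) (r s k : R).

(** The radial data of a conformal metric e^{2u} delta: f is the restriction of u
to a ray, f1 and f2 are its derivatives, and mu s is proportional to the area of
the disk of radius s.  The functions live on the whole line, negative radii
included, so that no one-sided derivative occurs at the origin. *)
Record profile f (f1 f2 : R -> R) mu : Prop := Profile {
  profile_der1 : forall s, is_derive s 1 f (f1 s);
  profile_der2 : forall s, is_derive s 1 f1 (f2 s);
  profile_mass0 : mu 0 = 0;
  profile_mass : forall s, is_derive s 1 mu (s * expR (2 * f s)) }.

(** This is s (Delta u + e^{2u}) at distance s from the origin. *)
Definition defect f (f1 f2 : R -> R) s := s * f2 s + f1 s + s * expR (2 * f s).

(** The divergence theorem in radial form. *)
Lemma is_derive_flux f (f1 f2 : R -> R) mu s : profile f f1 f2 mu ->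
  is_derive s 1 (fun t => t * f1 t + mu t) (defect f f1 f2 s).
Proof.
move=> [Hf Hf1 _ Hmu]; der.
by rewrite /defect; ring.
Qed.

(** The factor 1 + s f' is, up to a constant, the total geodesic curvature of the
circle of radius s: the first variation of length. *)
Lemma is_derive_length2 f (f1 f2 : R -> R) mu s : profile f f1 f2 mu ->
  is_derive s 1 (fun t => t ^+ 2 * expR (2 * f t))
                (2 * (1 + s * f1 s) * (s * expR (2 * f s))).
Proof.
move=> [Hf Hf1 _ Hmu]; der.
by rewrite /=; ring.
Qed.

Lemma is_derive_radius_slope f (f1 f2 : R -> R) mu s : profile f f1 f2 mu ->
  is_derive s 1 (fun t => 1 + t * f1 t) (defect f f1 f2 s - s * expR (2 * f s)).
Proof.
move=> [Hf Hf1 _ Hmu]; der.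
by rewrite /defect; ring.
Qed.

Lemma mass_incr f (f1 f2 : R -> R) mu s t : profile f f1 f2 mu -> 0 <= s < t -> mu s < mu t.
Proof.
move=> [_ _ _ Hmu] /andP[s0 st].
apply: (gt0_derive_lt st Hmu) => x /andP[sx _].
by rewrite mulr_gt0 ?expR_gt0 ?(le_lt_trans s0).
Qed.

Lemma mass_gt0 f (f1 f2 : R -> R) mu s : profile f f1 f2 mu -> 0 < s -> 0 < mu s.
Proof.
by move=> H s0; rewrite -(profile_mass0 H); apply: (mass_incr H); rewrite lexx.
Qed.

Lemma mass_lt f (f1 f2 : R -> R) mu g (g1 g2 : R -> R) nu r s :
  profile f f1 f2 mu -> profile g g1 g2 nu ->
  (forall s, 0 <= s < r -> f s < g s) -> 0 < s <= r -> mu s < nu s.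
Proof.
move=> H1 H2 fg /andP[s0 sr]; rewrite -subr_gt0.
have Hd (t : R) : is_derive t 1 (fun t => nu t - mu t)
    (t * expR (2 * g t) - t * expR (2 * f t)).
  by apply: is_derB; [exact: (profile_mass H2)|exact: (profile_mass H1)].
have -> : 0 = nu 0 - mu 0 by rewrite (profile_mass0 H1) (profile_mass0 H2) subrr.
apply: (gt0_derive_lt s0 Hd) => t /andP[t0 ts].
by rewrite -mulrBr mulr_gt0// subr_gt0 ltr_expR ltr_pM2l// fg// (ltW t0) (lt_le_trans ts).
Qed.

Section Inside.
Variables (f f1 f2 mu g g1 g2 nu : R -> R) (r : R).
Hypotheses (Hf : profile f f1 f2 mu) (Hg : profile g g1 g2 nu) (r0 : 0 < r).
Hypothesis df_le0 : forall s, 0 < s < r -> defect f f1 f2 s <= 0.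
Hypothesis df_dg : forall s, 0 < s < r -> defect f f1 f2 s <= defect g g1 g2 s.
Hypothesis fg : forall s, 0 <= s < r -> f s < g s.
Hypothesis fg_r : f r = g r.

Let delta s := nu s - mu s.
Let gap s := (s * g1 s + nu s) - (s * f1 s + mu s).
(* The weight for which Z r is a positive multiple of the excess. *)
Let k := delta r / (delta r + 2 * mu r).
Let Z s :=
  s ^+ 2 * expR (2 * g s) - s ^+ 2 * expR (2 * f s)
  - 2 * (1 + s * f1 s) * delta s + delta s ^+ 2
  - k * (s ^+ 2 * expR (2 * f s) - 2 * (1 + s * f1 s) * mu s - mu s ^+ 2).
Let dZ s := 2 * (s * expR (2 * g s)) * gap s
  + 2 * - defect f f1 f2 s * (delta s - k * mu s).

Let Zder s : is_derive s 1 Z (dZ s).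
Proof.
have L1 := is_derive_length2 s Hf; have L2 := is_derive_length2 s Hg.
have S1 := is_derive_radius_slope s Hf.
have M1 := profile_mass Hf s; have M2 := profile_mass Hg s.
rewrite /Z /delta; der.
by rewrite /dZ /delta /gap /=; ring.
Qed.

Let gap_der s : is_derive s 1 gap (defect g g1 g2 s - defect f f1 f2 s).
Proof. by apply: is_derB; apply: is_derive_flux; eassumption. Qed.

Let gap_ge0 s : 0 <= s <= r -> 0 <= gap s.
Proof.
move=> /andP[s0 sr]; have -> : 0 = gap 0.
  by rewrite /gap (profile_mass0 Hf) (profile_mass0 Hg); ring.
apply: (ge0_derive_le s0 gap_der) => t /andP[t0 ts].
by rewrite subr_ge0 df_dg// t0 (lt_le_trans ts).
Qed.

Let phi_der s : is_derive s 1 (fun t => delta t - k * mu t)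
  (s * expR (2 * g s) - (1 + k) * (s * expR (2 * f s))).
Proof.
have M1 := profile_mass Hf s; have M2 := profile_mass Hg s.
rewrite /delta; der.
by rewrite /=; ring.
Qed.

Let x_gt0 : 0 < mu r. Proof. exact: mass_gt0 Hf r0. Qed.
Let D_gt0 : 0 < delta r.
Proof. by rewrite subr_gt0; apply: (mass_lt Hf Hg fg); rewrite r0 lexx. Qed.
Let den_gt0 : 0 < delta r + 2 * mu r.
Proof. by apply: addr_gt0 => //; apply: mulr_gt0 => //; rewrite ltr0n. Qed.
Let k_gt0 : 0 < k.
Proof. exact: divr_gt0. Qed.

Let ZrE : (delta r + 2 * mu r) * Z r =
  delta r * (nu r ^+ 2 - 2 * (1 + r * f1 r) * nu r - r ^+ 2 * expR (2 * f r)).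
Proof.
have nz : delta r + 2 * mu r != 0 by rewrite gt_eqF.
have Ek : (delta r + 2 * mu r) * k = delta r by rewrite mulrC divfK.
rewrite /Z -fg_r mulrBr mulrA Ek.
have -> : nu r = delta r + mu r by rewrite /delta subrK.
ring.
Qed.

(** At s0 the curves delta and k mu cross upwards, so B >= (1 + k) A there, with A
and B the derivatives of mu and nu; this is what makes Z nonnegative at s0
without any information on what happens before s0. *)
Lemma crossing_radius :
  exists s0, [/\ 0 <= s0 < r, mu s0 ^+ 2 * k <= Z s0,
   forall s, s0 <= s <= r -> 0 <= delta s - k * mu s &
   forall s, s0 < s <= r -> 0 < delta s - k * mu s].
Proof.
have [||s [/andP[s0 sr] ds dds pos]] :=
  @last_crossing R (fun t => delta t - k * mu t) _ 0 r (ltW r0) phi_der.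
- by rewrite /delta (profile_mass0 Hf) (profile_mass0 Hg) !subr0 mulr0.
- have lt1 : k < 1.
    rewrite /k ltr_pdivrMr//.
    by rewrite mul1r ltrDl mulr_gt0.
  have nz : delta r + 2 * mu r != 0 by rewrite gt_eqF.
  have Ek : (delta r + 2 * mu r) * k = delta r by rewrite mulrC divfK.
  rewrite /= -{1}Ek (_ : _ - _ = k * (delta r + mu r)); last by ring.
  by rewrite mulr_gt0// addr_gt0.
exists s; split=> //; first by rewrite s0.
  have ed : delta s = k * mu s by apply/eqP; rewrite -subr_eq0 ds.
  have : 0 <= s * (s * expR (2 * g s) - (1 + k) * (s * expR (2 * f s))).
    by rewrite mulr_ge0.
  rewrite /Z ed => h.
  have k2 : 0 <= (k * mu s) ^+ 2 by rewrite sqr_ge0.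
  rewrite -subr_ge0 in h *.
  nra.
move=> t /andP[]; rewrite le_eqVlt => /predU1P[<- _|st tr]; first by rewrite ds.
by rewrite ltW// pos// st.
Qed.

Let dZ_ge0 s0 : 0 <= s0 ->
  (forall s, s0 <= s <= r -> 0 <= delta s - k * mu s) ->
  forall s, s0 < s < r -> 0 <= dZ s.
Proof.
move=> s0_ge0 pos s /andP[s0s sr].
have s_gt0 : 0 < s by exact: le_lt_trans s0s.
rewrite addr_ge0//.
  by rewrite mulr_ge0 ?gap_ge0 ?(ltW s_gt0) ?(ltW sr)// !mulr_ge0 ?expR_ge0// ltW.
by rewrite mulr_ge0 ?pos ?(ltW s0s) ?(ltW sr)// mulr_ge0// oppr_ge0 df_le0// s_gt0.
Qed.

(** Z increases on the interval from s0 to r, where delta >= k mu, and its value at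
r is a positive multiple of the excess. *)
Lemma inner_bound :
  0 <= nu r ^+ 2 - 2 * (1 + r * f1 r) * nu r - r ^+ 2 * expR (2 * f r).
Proof.
have [s0 [/andP[s00 s0r] Z0 pos _]] := crossing_radius.
have Zle := ge0_derive_le (ltW s0r) Zder (dZ_ge0 s00 pos).
have Zr : 0 <= Z r.
  by apply: le_trans Zle; apply: le_trans Z0; rewrite mulr_ge0 ?sqr_ge0 ?(ltW k_gt0).
have : 0 <= (delta r + 2 * mu r) * Z r by rewrite mulr_ge0// ltW.
by rewrite ZrE pmulr_rge0.
Qed.

(** If Z vanishes at r then mu vanishes at s0, so s0 is the origin and Z is zero
throughout; both nonnegative terms of its derivative must then vanish. *)
Lemma inner_rigidity :
  nu r ^+ 2 - 2 * (1 + r * f1 r) * nu r - r ^+ 2 * expR (2 * f r) = 0 ->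
  forall s, 0 < s < r -> defect f f1 f2 s = 0 /\ defect g g1 g2 s = 0.
Proof.
move=> E0; have [s0 [/andP[s00 s0r] Z0 pos posS]] := crossing_radius.
have Zr0 : Z r = 0.
  have := ZrE; rewrite E0 mulr0 => /eqP; rewrite mulf_eq0 => /orP[/eqP h|/eqP//].
  by move: den_gt0; rewrite h ltxx.
have Zle := ge0_derive_le (ltW s0r) Zder (dZ_ge0 s00 pos).
have mu0 : mu s0 = 0.
  have : mu s0 ^+ 2 * k <= 0 by rewrite (le_trans Z0)// -Zr0.
  rewrite pmulr_lle0// => h; apply/eqP; rewrite -sqrf_eq0 eq_le h sqr_ge0//.
have s0E : s0 = 0.
  apply/eqP; rewrite eq_le s00 andbT leNgt; apply/negP => s0_gt0.
  by have := mass_gt0 Hf s0_gt0; rewrite mu0 ltxx.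
move: pos posS Z0; rewrite {s0 s00 s0r Zle} s0E in mu0 * => pos posS Z0.
have Zcst s : 0 <= s <= r -> Z s = 0.
  move=> /andP[s0 sr]; apply/eqP; rewrite eq_le; apply/andP; split.
    rewrite -Zr0; apply: (ge0_derive_le sr Zder) => t /andP[st tr].
    by apply: (dZ_ge0 (lexx 0) pos); rewrite tr (le_lt_trans s0).
  apply: le_trans (ge0_derive_le s0 Zder _).
    by apply: le_trans Z0; rewrite mu0 expr0n mul0r.
  move=> t /andP[st tr].
  by apply: (dZ_ge0 (lexx 0) pos); rewrite st (lt_le_trans tr).
have near_in s : 0 < s < r -> \forall t \near s, 0 < t < r.
  move=> /andP[s0 sr]; near=> t; apply/andP; split; near: t.
    exact: lt_nbhsr. exact: lt_nbhsl.
have dZ0 s : 0 < s < r -> dZ s = 0.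
  move=> sr; apply: (is_derive_near_cst (Zder s) (c := 0)).
  apply: filterS (near_in s sr) => t /andP[t0 tr].
  by apply: Zcst; rewrite !ltW.
have key s : 0 < s < r -> gap s = 0 /\ defect f f1 f2 s = 0.
  move=> sr; have /andP[s0 sr'] := sr.
  have B0 : 0 < 2 * (s * expR (2 * g s)) by rewrite !mulr_gt0 ?expR_gt0.
  have g0 : 0 <= gap s by rewrite gap_ge0// !ltW.
  have a0 : 0 <= - defect f f1 f2 s by rewrite oppr_ge0 df_le0.
  have p0 : 0 < delta s - k * mu s by rewrite posS// s0 ltW.
  have /eqP := dZ0 s sr; rewrite /dZ paddr_eq0.
  - rewrite !mulf_eq0 (gt_eqF p0) (gt_eqF s0) (gt_eqF (expR_gt0 _)) oppr_eq0.
    rewrite pnatr_eq0/= !orbF => /andP[/eqP-> /eqP->]//.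
  - by rewrite mulr_ge0// ltW.
  - by rewrite mulr_ge0 ?(ltW p0)// mulr_ge0.
move=> s sr; have [_ df0] := key s sr; split=> //.
have : defect g g1 g2 s - defect f f1 f2 s = 0.
  apply: (is_derive_near_cst (gap_der s) (c := 0)).
  by apply: filterS (near_in s sr) => t /key[].
by rewrite df0 subr0.
Unshelve. all: by end_near. Qed.

End Inside.
End Profiles.

(** * Rotationally symmetric metrics: the exterior, and curvature one *)

Section Outside.
Context {R : realType}.
Variables (f f1 f2 mu : R -> R) (r : R).
Hypotheses (Hf : profile f f1 f2 mu) (r0 : 0 < r).
Hypothesis df_le0 : forall s : R, r < s -> defect f f1 f2 s <= 0.

Let c := 1 + r * f1 r.
Let P := r ^+ 2 * expR (2 * f r).
Let n s := mu s - mu r.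
Let Th s := P + 2 * c * n s - n s ^+ 2 - s ^+ 2 * expR (2 * f s).
Let slack s := (r * f1 r + mu r) - (s * f1 s + mu s).

Let P_gt0 : 0 < P. Proof. by rewrite mulr_gt0 ?expR_gt0// exprn_gt0. Qed.

Let slack_der (s : R) : is_derive s 1 slack (- defect f f1 f2 s).
Proof.
have H := is_derive_flux s Hf.
eapply is_der_eq; first by eapply is_derB; [eapply is_derC|exact H].
by rewrite sub0r.
Qed.

Let slack_ge0 s : r <= s -> 0 <= slack s.
Proof.
move=> rs; have -> : 0 = slack r by rewrite /slack subrr.
apply: (ge0_derive_le rs slack_der) => t /andP[rt _].
by rewrite oppr_ge0 df_le0.
Qed.

Let Th_der (s : R) : is_derive s 1 Th (2 * (s * expR (2 * f s)) * slack s).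
Proof.
have L := is_derive_length2 s Hf; have M := profile_mass Hf s.
rewrite /Th /n; der.
by rewrite /slack /c /=; ring.
Qed.

Let Th_incr s t : r <= s -> s <= t -> Th s <= Th t.
Proof.
move=> rs st; apply: (ge0_derive_le st Th_der) => x /andP[sx _].
have rx : r < x by exact: le_lt_trans sx.
by rewrite !mulr_ge0 ?expR_ge0 ?slack_ge0// ltW// (lt_trans r0).
Qed.

Let Thr : Th r = 0. Proof. by rewrite /Th /n subrr /P; ring. Qed.

(** The function Th measures the deficit in the isoperimetric identity of a surface
of curvature one with the same boundary data; Th >= 0 reads n^2 - 2 c n - P <= - p < 0,
so n lies below the positive root. *)
Lemma outer_bound y s : 0 < y -> 0 <= y ^+ 2 - 2 * c * y - P -> r <= s ->
  mu s < mu r + y.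
Proof.
move=> y0 Ey rs; rewrite ltNge; apply/negP => h.
have ny : y <= n s by rewrite lerBrDl.
have Th0 : 0 <= Th s by rewrite -Thr Th_incr.
have p0 : 0 < s ^+ 2 * expR (2 * f s).
  by rewrite mulr_gt0 ?expR_gt0// exprn_gt0// (lt_le_trans r0).
have := P_gt0; move: Ey Th0 p0; rewrite /Th.
move: (n s) (s ^+ 2 * _) ny c P => N p ny c' P' Ey Th0 p0 P0.
(* The quadratic is negative between 0 and its positive root. *)
have y2c : 0 < y - 2 * c'.
  have : 0 < y * (y - 2 * c') by lra.
  by rewrite pmulr_rgt0.
nra.
Qed.

(** When the mass comes arbitrarily close to its bound, letting n tend to y in
n^2 - 2 c n - P <= - Th t gives y^2 - 2 c y - P <= - Th t for every t. *)
Lemma outer_rigidity y : 0 < y -> 0 <= y ^+ 2 - 2 * c * y - P ->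
  (forall e, 0 < e -> exists2 s, r <= s & mu r + y - e < mu s) ->
  y ^+ 2 - 2 * c * y - P = 0 /\ forall s, r < s -> defect f f1 f2 s = 0.
Proof.
move=> y0 Ey sup_y.
have EyTh t : r <= t -> y ^+ 2 - 2 * c * y - P <= - Th t.
  move=> rt; rewrite leNgt; apply/negP => h.
  (* K bounds the Lipschitz constant of n^2 - 2 c n for n between 0 and y. *)
  pose K := 2 * y + 2 * `|c| + 1.
  have K0 : 0 < K by rewrite /K; have := normr_ge0 c; lra.
  pose gapE := y ^+ 2 - 2 * c * y - P + Th t.
  have gE0 : 0 < gapE by rewrite /gapE; lra.
  have [s rs ms] := sup_y (gapE / K) (divr_gt0 gE0 K0).
  pose s' := Num.max s t.
  have ts' : t <= s' by rewrite le_max lexx orbT.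
  have rs' : r <= s' by exact: le_trans ts'.
  have ms' : mu s <= mu s'.
    have : s <= s' by rewrite le_max lexx.
    rewrite le_eqVlt => /predU1P[<-//|ss']; apply/ltW/(mass_incr Hf).
    by rewrite ss' (le_trans (ltW r0)).
  have ny : n s' < y by rewrite ltrBlDl outer_bound.
  have yn : (y - n s') * K < gapE.
    rewrite -ltr_pdivlMr//; rewrite /n; lra.
  have Ths : Th t <= Th s' by exact: Th_incr.
  have n0 : 0 <= n s'.
    rewrite subr_ge0; move: rs'; rewrite le_eqVlt => /predU1P[<-//|ss'].
    by apply/ltW/(mass_incr Hf); rewrite ss' ltW.
  have p0 : 0 <= s' ^+ 2 * expR (2 * f s') by rewrite mulr_ge0 ?expR_ge0// sqr_ge0.
  move: Ths yn; rewrite {2}/Th /gapE /K.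
  move: p0 n0 ny; move: (s' ^+ 2 * _) (n s') (Th t) => p N T p0 n0 ny h1 h2.
  have c1 : c <= `|c| by rewrite ler_norm.
  have c2 : - c <= `|c| by rewrite -normrN ler_norm.
  nra.
have Th0 t : r <= t -> Th t = 0.
  move=> rt; have := EyTh t rt; have : 0 <= Th t by rewrite -Thr Th_incr.
  by move=> a b; apply/eqP; rewrite eq_le a andbT; lra.
split; first by apply/eqP; rewrite eq_le Ey andbT; have := EyTh r (lexx r); rewrite Thr oppr0.
have near_out s : r < s -> \forall t \near s, r < t by exact: lt_nbhsr.
have slack0 s : r < s -> slack s = 0.
  move=> rs; have : 2 * (s * expR (2 * f s)) * slack s = 0.
    apply: (is_derive_near_cst (Th_der s) (c := 0)).
    by apply: filterS (near_out s rs) => t rt; rewrite Th0// ltW.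
  move=> /eqP; rewrite !mulf_eq0 pnatr_eq0/= (gt_eqF (expR_gt0 _)).
  by rewrite (gt_eqF (lt_trans r0 rs))/= => /eqP.
move=> s rs; apply/eqP; rewrite -oppr_eq0; apply/eqP.
apply: (is_derive_near_cst (slack_der s) (c := 0)).
by apply: filterS (near_out s rs) => t rt; rewrite slack0.
Qed.

End Outside.

Section Spherical.
Context {R : realType}.

Lemma flux_constant (f f1 f2 mu : R -> R) (a b : R) : profile f f1 f2 mu -> a <= b ->
  (forall s, a < s < b -> defect f f1 f2 s = 0) ->
  a * f1 a + mu a = b * f1 b + mu b.
Proof.
by move=> Hf ab h; apply: (eq0_derive_eq ab (fun s => is_derive_flux s Hf) h).
Qed.

Variables (f f1 f2 mu : R -> R) (b : R).
Hypotheses (Hf : profile f f1 f2 mu).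
Hypothesis df0 : forall s : R, 0 < s < b -> defect f f1 f2 s = 0.

Lemma spherical_flux s : 0 <= s <= b -> s * f1 s = - mu s.
Proof.
move=> /andP[s0 sb]; apply/eqP; rewrite -addr_eq0; apply/eqP.
rewrite -(flux_constant Hf s0); first by rewrite (profile_mass0 Hf); ring.
by move=> t /andP[t0 ts]; apply: df0; rewrite t0 (lt_le_trans ts).
Qed.

(** The equality case of the isoperimetric inequality in the unit sphere. *)
Lemma spherical_length s : 0 <= s <= b ->
  s ^+ 2 * expR (2 * f s) = mu s * (2 - mu s).
Proof.
move=> /andP[s0 sb].
have D (t : R) : is_derive t 1 (fun t => t ^+ 2 * expR (2 * f t) - mu t * (2 - mu t))
    (2 * (t * expR (2 * f t)) * (t * f1 t + mu t)).
  have L := is_derive_length2 t Hf; have M := profile_mass Hf t.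
  by der; rewrite /=; ring.
have := eq0_derive_eq s0 D; rewrite (profile_mass0 Hf) expr0n/= !mul0r subrr.
move=> h; apply/eqP; rewrite -subr_eq0 -h// => t /andP[t0 ts].
by rewrite spherical_flux ?addNr ?mulr0// !ltW// (lt_le_trans ts).
Qed.

Lemma spherical_mass_lt2 s : 0 < s <= b -> mu s < 2.
Proof.
move=> /andP[s0 sb]; have : 0 < mu s * (2 - mu s).
  by rewrite -spherical_length ?sb ?(ltW s0)// mulr_gt0 ?expR_gt0// exprn_gt0.
by rewrite pmulr_rgt0 ?subr_gt0// (mass_gt0 Hf).
Qed.

(** The equation s mu' = mu (2 - mu) is separable, and this ratio is its first
integral. *)
Lemma spherical_mass_ratio (s t : R) : 0 < s -> s <= t -> t <= b ->
  mu s / (s ^+ 2 * (2 - mu s)) = mu t / (t ^+ 2 * (2 - mu t)).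
Proof.
move=> s0 st tb.
have xgt0 x : s <= x <= t -> 0 < x /\ 0 < 2 - mu x.
  move=> /andP[sx xt]; have x0 : 0 < x by exact: lt_le_trans sx.
  by split=> //; rewrite subr_gt0 spherical_mass_lt2// x0 (le_trans xt).
apply: (eq0_derive_eq_on (f := fun x => mu x / (x ^+ 2 * (2 - mu x)))
  (df := fun x => ((mu x * (2 - mu x) - x ^+ 2 * expR (2 * f x)) * - 2)
     / (x ^+ 3 * (2 - mu x) ^+ 2)) st).
- move=> x xst; have [x0 m0] := xgt0 x xst.
  have M := profile_mass Hf x.
  have V : x ^+ 2 * (2 - mu x) != 0 by rewrite gt_eqF// mulr_gt0// exprn_gt0.
  have D : is_derive x 1 (fun x => x ^+ 2 * (2 - mu x))
      (2 * x * (2 - mu x) - x ^+ 2 * (x * expR (2 * f x))).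
    by der; rewrite /=; ring.
  eapply is_der_eq; first by eapply is_derM; [exact M|eapply is_derV; [exact: V|exact: D]].
  by rewrite /=; field; rewrite !gt_eqF.
- move=> x /andP[sx xt]; rewrite spherical_length ?subrr ?mul0r//.
  by rewrite (ltW (lt_trans s0 sx)) (ltW (lt_le_trans xt tb)).
Qed.

End Spherical.

Section SphericalForm.
Context {R : realType}.

Lemma mass_from_ratio (k s m : R) : 0 < s -> 0 < m < 2 ->
  m / (s ^+ 2 * (2 - m)) = k ->
  0 < k /\ m = 2 * (k * s ^+ 2) / (1 + k * s ^+ 2).
Proof.
move=> s0 /andP[m0 m2] <-.
have s2 : s ^+ 2 != 0 by rewrite gt_eqF// exprn_gt0.
have m2' : 0 < 2 - m by rewrite subr_gt0.
split; first by rewrite divr_gt0// mulr_gt0// exprn_gt0.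
have -> : m / (s ^+ 2 * (2 - m)) * s ^+ 2 = m / (2 - m).
  by field; rewrite (gt_eqF m2') gt_eqF.
have n1 : 1 + m / (2 - m) = 2 / (2 - m) by field; rewrite gt_eqF.
by rewrite n1; field; rewrite gt_eqF.
Qed.

(** The first integral gives mu, hence the density, for positive s; the value at the
origin follows by continuity. *)
Lemma spherical_density (f f1 f2 mu : R -> R) (b : R) : profile f f1 f2 mu -> 0 < b ->
  (forall s, 0 < s < b -> defect f f1 f2 s = 0) ->
  exists2 k, 0 < k & mu b = 2 * (k * b ^+ 2) / (1 + k * b ^+ 2) /\
    forall s, 0 <= s < b -> expR (2 * f s) = 4 * k / (1 + k * s ^+ 2) ^+ 2.
Proof.
move=> Hf b0 df0.
have mb s : 0 < s <= b -> 0 < mu s < 2.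
  move=> /andP[s0 sb]; rewrite (mass_gt0 Hf s0)/=.
  by apply: (spherical_mass_lt2 Hf df0); rewrite s0.
pose k := mu b / (b ^+ 2 * (2 - mu b)).
have ratio s : 0 < s <= b -> mu s / (s ^+ 2 * (2 - mu s)) = k.
  by move=> /andP[s0 sb]; exact: (spherical_mass_ratio Hf df0 s0 sb (lexx b)).
have bb : 0 < b <= b by rewrite b0 lexx.
have [k0 mbE] := mass_from_ratio b0 (mb b bb) (ratio b bb); clearbody k.
exists k => //; split=> //.
have pos s : 0 < 1 + k * s ^+ 2 by rewrite ltr_pwDl// mulr_ge0 ?sqr_ge0// ltW.
have E s : 0 < s <= b -> expR (2 * f s) = 4 * k / (1 + k * s ^+ 2) ^+ 2.
  move=> sb; have /andP[s0 sb'] := sb.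
  have s2 : s ^+ 2 != 0 by rewrite gt_eqF// exprn_gt0.
  have [_ ms] := mass_from_ratio s0 (mb s sb) (ratio s sb).
  have L : s ^+ 2 * expR (2 * f s) = mu s * (2 - mu s).
    by apply: (spherical_length Hf df0); rewrite (ltW s0).
  apply: (mulfI s2); rewrite L ms; field.
  by rewrite gt_eqF.
move=> s /andP[]; rewrite le_eqVlt => /predU1P[<- _|s0 sb]; last by rewrite E// s0 ltW.
have H : continuous (fun s => expR (2 * f s) - 4 * k / (1 + k * s ^+ 2) ^+ 2).
  have D1 := profile_der1 Hf.
  apply: (@is_derive_continuous _ _ (fun s => expR (2 * f s) * (2 * f1 s)
     + 16 * k ^+ 2 * s / (1 + k * s ^+ 2) ^+ 3)) => t.
  have D : is_derive t 1 (fun s => (1 + k * s ^+ 2) ^+ 2) (4 * k * t * (1 + k * t ^+ 2)).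
    by der; rewrite /=; ring.
  have n0 : (1 + k * t ^+ 2) ^+ 2 != 0 by rewrite gt_eqF// exprn_gt0.
  have DV := @is_derV R (fun s => (1 + k * s ^+ 2) ^+ 2) t _ n0 D.
  der; rewrite /=; field.
  by rewrite gt_eqF.
apply/eqP; rewrite -subr_eq0; apply/negPn/negP => ne.
have : \forall t \near (0 : R), expR (2 * f t) - 4 * k / (1 + k * t ^+ 2) ^+ 2 != 0.
  exact: (H 0 _ (open_nbhs_nbhs (conj (@open_neq R 0) ne))).
move=> /nbhs_ballP[e /= e0 He].
pose t := Num.min (e / 2) b.
have t0 : 0 < t by rewrite lt_min divr_gt0.
have te : t < e by rewrite gt_min ltr_pdivrMr// ltr_pMr// ltr1n.
have /He : ball 0 e t by rewrite /ball/= sub0r normrN gtr0_norm.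
by rewrite /= E ?subrr ?eqxx// t0 ge_min lexx orbT.
Qed.

(** The mass 2 k s^2 / (1 + k s^2) tends to 2, the normalized area of the sphere. *)
Lemma spherical_mass_cvg (f f1 f2 mu : R -> R) (r e : R) : profile f f1 f2 mu -> 0 < r ->
  (forall s, 0 < s -> defect f f1 f2 s = 0) -> 0 < e ->
  exists2 s, r <= s & 2 - e < mu s.
Proof.
move=> Hf r0 df0 e0.
have df b s : 0 < s < b -> defect f f1 f2 s = 0 by move=> /andP[+ _]; exact: df0.
have mb s : 0 < s -> 0 < mu s < 2.
  move=> s0; rewrite (mass_gt0 Hf s0)/=.
  by apply: (spherical_mass_lt2 Hf (df s)); rewrite s0 lexx.
have [k0 _] := mass_from_ratio r0 (mb r r0) erefl.
set k := mu r / _ in k0.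
pose s := Num.max r (Num.max 1 (2 / (k * e))).
have rs : r <= s by rewrite le_max lexx.
have s1 : 1 <= s by rewrite !le_max lexx orbT.
have s2 : 2 / (k * e) <= s by rewrite !le_max lexx !orbT.
have s0 : 0 < s by exact: lt_le_trans r0 rs.
have rE : mu s / (s ^+ 2 * (2 - mu s)) = k.
  exact: (esym (spherical_mass_ratio Hf (df s) r0 rs (lexx s))).
have [_ ms] := mass_from_ratio s0 (mb s s0) rE.
exists s => //; rewrite ms.
have ke : 0 < k * e by rewrite mulr_gt0.
have ss : s <= s ^+ 2 by rewrite expr2 ler_peMr// ltW.
have h : 2 <= k * s ^+ 2 * e.
  by move: s2; rewrite ler_pdivrMr// => h; rewrite mulrAC (le_trans h)// mulrC ler_pM2l.
have q0 : 0 < 1 + k * s ^+ 2 by rewrite ltr_pwDl// mulr_ge0 ?sqr_ge0// ltW.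
by rewrite ltr_pdivlMr//; lra.
Qed.

(** Two complementary caps are the only different caps with equal boundaries. *)
Lemma spherical_mass_sum (x y P : R) : x < y -> P = x * (2 - x) -> P = y * (2 - y) ->
  x + y = 2.
Proof.
move=> xy -> h; have : (y - x) * (x + y - 2) = 0 by lra.
move/eqP; rewrite mulf_eq0 subr_eq0 (gt_eqF xy)/= subr_eq0 => /eqP//.
Qed.

End SphericalForm.

(** * Radial functions on the plane *)

Section Slices.
Context {R : realType} {W : normedModType R}.
Implicit Types (u : R * R -> W) (x y : R).

Let slope1 u x y : (fun h : R => h^-1 *: ((u \o shift (x, y)) (h *: e1) - u (x, y))) =
  (fun h : R => h^-1 *: (((fun t => u (t, y)) \o shift x) (h *: 1) - u (x, y))).
Proof.
apply/funext => h /=; congr (_ *: (u _ - _)).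
by rewrite /e1 -[LHS]/(h * 1 + x, h * 0 + y) mulr0 add0r.
Qed.

Let slope2 u x y : (fun h : R => h^-1 *: ((u \o shift (x, y)) (h *: e2) - u (x, y))) =
  (fun h : R => h^-1 *: (((fun t => u (x, t)) \o shift y) (h *: 1) - u (x, y))).
Proof.
apply/funext => h /=; congr (_ *: (u _ - _)).
by rewrite /e2 -[LHS]/(h * 0 + x, h * 1 + y) mulr0 add0r.
Qed.

(** Restricting u to a line parallel to an axis makes the results on functions of one
variable, such as the mean value theorem, available for partial derivatives. *)
Lemma derivable_slice1 u x y :
  derivable u (x, y) e1 = derivable (fun t => u (t, y)) x 1.
Proof. by rewrite /derivable slope1. Qed.

Lemma derivable_slice2 u x y :
  derivable u (x, y) e2 = derivable (fun t => u (x, t)) y 1.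
Proof. by rewrite /derivable slope2. Qed.

Lemma derive_slice1 u x y : 'D_e1 u (x, y) = 'D_1 (fun t => u (t, y)) x.
Proof. by rewrite /derive slope1. Qed.

Lemma derive_slice2 u x y : 'D_e2 u (x, y) = 'D_1 (fun t => u (x, t)) y.
Proof. by rewrite /derive slope2. Qed.

Lemma is_derive_slice1 u x y : derivable u (x, y) e1 ->
  is_derive x 1 (fun t => u (t, y)) ('D_e1 u (x, y)).
Proof.
by rewrite derivable_slice1 derive_slice1 => /derivableP.
Qed.

Lemma is_derive_slice2 u x y : derivable u (x, y) e2 ->
  is_derive y 1 (fun t => u (x, t)) ('D_e2 u (x, y)).
Proof.
by rewrite derivable_slice2 derive_slice2 => /derivableP.
Qed.

End Slices.

Section Radial.
Context {R : realType}.

Lemma is_derive_sqrt_sum (t c : R) : 0 < t ^+ 2 + c ->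
  is_derive t 1 (fun t => Num.sqrt (t ^+ 2 + c)) (t / Num.sqrt (t ^+ 2 + c)).
Proof.
move=> h; eapply is_der_eq.
  eapply (@is_derive1_comp R Num.sqrt (fun t => t ^+ 2 + c) t).
    exact: is_derive1_sqrt.
  by der; reflexivity.
have s0 : Num.sqrt (t ^+ 2 + c) != 0 by rewrite gt_eqF// sqrtr_gt0.
by rewrite /= -/(t ^+ 2 + c); field.
Qed.

Variable u : R * R -> R.
Hypotheses (u_smooth : smooth_on setT u) (u_radial : radial u).

Definition ray0 (s : R) := u (s, 0).
Definition ray1 (s : R) := 'D_e1 u (s, 0).
Definition ray2 (s : R) := 'D_e1 ('D_e1 u) (s, 0).

Lemma is_derive_ray0 (s : R) : is_derive s 1 ray0 (ray1 s).
Proof.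
have [_ [/(_ (s, 0) I)[d _] _ _]] := u_smooth 1; exact: is_derive_slice1.
Qed.

Lemma is_derive_ray1 (s : R) : is_derive s 1 ray1 (ray2 s).
Proof.
have [_ [_ [_ [/(_ (s, 0) I)[d _] _ _]] _]] := u_smooth 2; exact: is_derive_slice1.
Qed.

Lemma radialE x : u x = ray0 (Num.sqrt (dot2 x x)).
Proof.
apply: u_radial; rewrite {2}/dot2/= mulr0 addr0 -expr2 sqr_sqrtr//.
by rewrite addr_ge0// -expr2 sqr_ge0.
Qed.

Let rho t c := Num.sqrt (t ^+ 2 + c) : R.

Let is_derive_radial1 (t c : R) : 0 < t ^+ 2 + c ->
  is_derive t 1 (fun t => ray0 (rho t c)) (ray1 (rho t c) * (t / rho t c)).
Proof.
move=> h; eapply (@is_derive1_comp R ray0 (fun t => rho t c) t).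
  exact: is_derive_ray0.
exact: is_derive_sqrt_sum.
Qed.

Let is_derive_radial2 (t c : R) : 0 < t ^+ 2 + c ->
  is_derive t 1 (fun t => ray1 (rho t c) * (t / rho t c))
   (ray2 (rho t c) * t ^+ 2 / (t ^+ 2 + c)
    + ray1 (rho t c) / rho t c * (1 - t ^+ 2 / (t ^+ 2 + c))).
Proof.
move=> h; have D := is_derive_sqrt_sum h.
have s0 : rho t c != 0 by rewrite gt_eqF// sqrtr_gt0.
have D1 : is_derive t 1 (fun t => ray1 (rho t c)) (ray2 (rho t c) * (t / rho t c)).
  eapply (@is_derive1_comp R ray1 (fun t => rho t c) t); last exact: D.
  exact: is_derive_ray1.
have D2 : is_derive t 1 (fun t => (rho t c)^-1) (- (rho t c) ^- 2 * (t / rho t c)).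
  exact: is_derV.
der.
have e : t ^+ 2 + c = rho t c ^+ 2 by rewrite sqr_sqrtr// ltW.
by rewrite e /=; field.
Qed.

Let near_pos (t c : R) : 0 < t ^+ 2 + c -> \forall s \near t, 0 < s ^+ 2 + c.
Proof.
move=> h; have C : continuous (fun s : R => s ^+ 2 + c).
  apply: (@is_derive_continuous _ _ (fun s => 2 * s)) => s.
  by der; rewrite /=; ring.
exact: (C t _ (lt_nbhsr h)).
Qed.

Let D1_radial a b : 0 < a ^+ 2 + b ^+ 2 ->
  'D_e1 u (a, b) = ray1 (rho a (b ^+ 2)) * (a / rho a (b ^+ 2)).
Proof.
move=> h; rewrite derive_slice1.
have -> : (fun t => u (t, b)) = (fun t => ray0 (rho t (b ^+ 2))).
  by apply/funext => t; rewrite radialE.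
by have [_ ->] := is_derive_radial1 h.
Qed.

Let D2_radial a b : 0 < a ^+ 2 + b ^+ 2 ->
  'D_e2 u (a, b) = ray1 (rho b (a ^+ 2)) * (b / rho b (a ^+ 2)).
Proof.
rewrite addrC => h; rewrite derive_slice2.
have -> : (fun t => u (a, t)) = (fun t => ray0 (rho t (a ^+ 2))).
  by apply/funext => t; rewrite radialE /rho /dot2/= addrC.
by have [_ ->] := is_derive_radial1 h.
Qed.

(** Both second derivatives are computed from u = ray0 (sqrt (x1^2 + x2^2)) along
the lines parallel to the axes. *)
Lemma radial_laplacian x : 0 < dot2 x x ->
  let s := Num.sqrt (dot2 x x) in laplacian u x = ray2 s + ray1 s / s.
Proof.
case: x => a b; rewrite /dot2/= -!expr2 => h.
rewrite /laplacian derive_slice1 derive_slice2.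
have h' : 0 < b ^+ 2 + a ^+ 2 by rewrite addrC.
rewrite (near_eq_derive _ (g := fun t => ray1 (rho t (b ^+ 2)) * (t / rho t (b ^+ 2)))); first last.
- by apply: filterS (near_pos h) => t ht; rewrite D1_radial.
rewrite (near_eq_derive _ (f := fun t => 'D_e2 u (a, t))
  (g := fun t => ray1 (rho t (a ^+ 2)) * (t / rho t (a ^+ 2)))); first last.
- by apply: filterS (near_pos h') => t ht; rewrite D2_radial// addrC.
have [_ ->] := is_derive_radial2 h; have [_ ->] := is_derive_radial2 h'.
have -> : rho b (a ^+ 2) = rho a (b ^+ 2) by rewrite /rho addrC.
rewrite -/(rho a (b ^+ 2)).
have s0 : rho a (b ^+ 2) != 0 by rewrite gt_eqF// sqrtr_gt0.
have e : a ^+ 2 + b ^+ 2 = rho a (b ^+ 2) ^+ 2 by rewrite sqr_sqrtr// ltW.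
have eb : b ^+ 2 = rho a (b ^+ 2) ^+ 2 - a ^+ 2 by rewrite -e; ring.
rewrite (addrC (b ^+ 2)) e; move: (rho a _) s0 eb => s s0 eb.
by rewrite eb; field.
Qed.

Lemma radial_defect x : 0 < dot2 x x ->
  defect ray0 ray1 ray2 (Num.sqrt (dot2 x x)) =
  Num.sqrt (dot2 x x) * (laplacian u x + expR (2 * u x)).
Proof.
move=> h; rewrite radial_laplacian// radialE /defect.
have s0 : Num.sqrt (dot2 x x) != 0 by rewrite gt_eqF// sqrtr_gt0.
by field.
Qed.

End Radial.

Section OnARay.
Context {R : realType}.

Lemma ray_defect (u : R * R -> R) (s : R) : smooth_on setT u -> radial u -> 0 < s ->
  defect (ray0 u) (ray1 u) (ray2 u) s = s * (laplacian u (s, 0) + expR (2 * u (s, 0))).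
Proof.
move=> us ur s0; have d : dot2 (s, 0) (s, 0) = s ^+ 2 by rewrite /dot2/= mulr0 addr0 expr2.
have e : Num.sqrt (dot2 (s, 0) (s, 0)) = s by rewrite d sqrtr_sqr gtr0_norm.
by have := radial_defect us ur (x := (s, 0)); rewrite e d exprn_gt0// => ->.
Qed.

Lemma disk_ray (r s : R) : 0 < r -> 0 <= s -> disk r (s, 0) <-> s < r.
Proof.
move=> r0 s0; rewrite /disk/= /dot2/= mulr0 addr0 -expr2.
by rewrite ltr_sqr// nnegrE// ltW.
Qed.

End OnARay.

(** * The area of disks *)

Section DiskVolume.
Context {R : realType}.
Local Notation leb := (@lebesgue_measure R).
Local Notation leb2 := (@lebesgue_measure R \x @lebesgue_measure R)%E.

Lemma measurable_dot2 : measurable_fun [set: R * R] (fun x => dot2 x x).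
Proof.
by apply: measurable_funD; apply: measurable_funM;
  (exact: measurable_fst || exact: measurable_snd).
Qed.

Lemma measurable_disk (s : R) : measurable (disk s).
Proof.
rewrite (_ : disk s = setT `&` (fun x => dot2 x x) @^-1` `]-oo, s ^+ 2[%classic).
  by apply: measurable_dot2.
by apply/seteqP; split => x /=; rewrite /disk/= in_itv/= => // -[].
Qed.

Lemma leb_disk_section (s x : R) :
  leb (xsection (disk s) x) = (2 * Num.sqrt (s ^+ 2 - x ^+ 2))%:E.
Proof.
set c := s ^+ 2 - x ^+ 2.
have -> : xsection (disk s) x = [set` `]- Num.sqrt c, Num.sqrt c[].
  apply/seteqP; split => y; rewrite /xsection/= inE /disk/= in_itv/= /dot2/= -!expr2.
    move=> h; have : y ^+ 2 < c by rewrite /c; lra.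
    move=> yc; rewrite -ltr_norml -sqrtr_sqr ltr_sqrt//.
    by rewrite (le_lt_trans (sqr_ge0 y)).
  rewrite -ltr_norml -sqrtr_sqr => h.
  have c0 : 0 < c.
    rewrite ltNge; apply/negP => c0.
    by move: h; rewrite (ler0_sqrtr c0) ltNge sqrtr_ge0.
  by move: h; rewrite ltr_sqrt// /c; lra.
rewrite lebesgue_measure_itv/= lte_fin; case: ifPn => h.
  by rewrite -EFinD; congr EFin; ring.
have : Num.sqrt c <= 0.
  by move: h; rewrite -leNgt; lra.
move=> /(conj (sqrtr_ge0 c))/andP; rewrite -eq_le => /eqP <-.
by rewrite mulr0.
Qed.

Let half (s x : R) : R := 2 * Num.sqrt (s ^+ 2 - x ^+ 2).

Let half_cont s : continuous (half s).
Proof.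
move=> x; apply: (@continuousM R R (cst 2) (fun x => Num.sqrt (s ^+ 2 - x ^+ 2))).
  exact: cst_continuous.
have c1 : continuous (fun x : R => s ^+ 2 - x ^+ 2).
  apply: (@is_derive_continuous _ _ (fun x => - (2 * x))) => {}x.
  by der; rewrite /=; ring.
exact: (continuous_comp (c1 x) (@sqrt_continuous R _)).
Qed.

Lemma leb2_diskE (s : R) : 0 <= s ->
  leb2 (disk s) = (\int[leb]_(x in `[(- s)%R, s]) (2 * Num.sqrt (s ^+ 2 - x ^+ 2))%R%:E)%E.
Proof.
move=> s0; rewrite /product_measure1.
under eq_integral do rewrite /= leb_disk_section.
rewrite [RHS]integral_mkcond/=; apply: eq_integral => x _.
rewrite patchE; case: ifPn => //; rewrite notin_setE/= in_itv/= => h.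
rewrite ler0_sqrtr ?mulr0// subr_le0.
have : ~~ (`|x| <= s) by rewrite ler_norml; apply/negP.
rewrite -ltNge => sx; rewrite -(real_normK (num_real x)).
by rewrite ler_sqr ?nnegrE// ltW.
Qed.

(** The area of the disk is the integral of the lengths of its vertical sections;
the substitution x = s t in that integral pulls out the factor s^2. *)
Lemma leb2_disk_scale (s : R) : leb2 (disk s) = ((s ^+ 2)%:E * leb2 (disk 1))%E.
Proof.
have half_meas t D : measurable D -> measurable_fun D (fun x => (half t x)%:E).
  move=> mD; apply/measurable_EFinP/measurable_funTS.
  by apply: continuous_measurable_fun; exact: half_cont.
wlog s0 : s / 0 < s.
  move=> H; have [s0|s0|->] := ltgtP s 0; [|exact: H|].
    have -> : disk s = disk (- s) by rewrite /disk sqrrN.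
    by rewrite -sqrrN H// oppr_gt0.
  rewrite expr0n mul0e (_ : disk 0 = set0) ?measure0//.
  apply/seteqP; split=> x //=; rewrite /disk/= expr0n/= ltNge.
  by rewrite addr_ge0// -expr2 sqr_ge0.
have dF (x : R) : is_derive x 1 (fun x => s * x) s by der; rewrite /=; ring.
have F'E : (fun x : R => s * x)^`()%classic = cst s.
  by apply/funext => x; rewrite derive1E; have [_ ->] := dF x.
have cF := is_derive_continuous dF.
rewrite leb2_diskE ?(ltW s0)//.
have -> : (`[(- s)%R, s]%classic : set R) =
    `[((fun x => s * x) (- 1))%R, ((fun x => s * x) 1)%R]%classic.
  by rewrite mulrN1 mulr1.
rewrite (integration_by_substitution_increasing (G := half s)); last first.
- by apply: continuous_subspaceT; exact: half_cont.
- split; first by move=> x _; exact: ex_derive.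
    by apply: cvg_at_right_filter; exact: cF.
  by apply: cvg_at_left_filter; exact: cF.
- by rewrite F'E; apply: is_cvg_cst.
- by rewrite F'E; apply: is_cvg_cst.
- by rewrite F'E => x _; exact: cst_continuous.
- by move=> x y _ _ xy; rewrite ltr_pM2l.
- lra.
rewrite leb2_diskE// -ge0_integralZl_EFin//.
- apply: eq_integral => x _; rewrite F'E -EFinM; congr EFin.
  rewrite -[LHS]/(2 * Num.sqrt (s ^+ 2 - (s * x) ^+ 2) * s).
  have -> : s ^+ 2 - (s * x) ^+ 2 = s ^+ 2 * (1 ^+ 2 - x ^+ 2) by ring.
  by rewrite sqrtrM ?sqr_ge0// sqrtr_sqr gtr0_norm//; ring.
- exact: half_meas.
- exact: sqr_ge0.
Qed.

Let leb2_box (a : R) : 0 <= a ->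
  leb2 (`[- a, a] `*` `[- a, a])%classic = ((2 * a) ^+ 2)%:E.
Proof.
move=> a0; have L : leb `[- a, a]%classic = (2 * a)%:E.
  rewrite lebesgue_measure_itv/= lte_fin; case: ifPn => h.
    by rewrite -EFinD; congr EFin; ring.
  have -> : a = 0 by move: h; rewrite -leNgt; lra.
  by rewrite mulr0.
have mI : measurable (`[- a, a]%classic : set R) by exact: measurable_itv.
transitivity (leb `[(- a)%R, a]%classic * leb `[(- a)%R, a]%classic)%E.
  exact: (product_measure1E leb leb mI mI).
by rewrite L -EFinM expr2.
Qed.

(** The unit disk contains a square of side 1 and is contained in one of side 2. *)
Lemma leb2_disk1 : exists2 C : R, 0 < C & leb2 (disk 1) = C%:E.
Proof.
have up : (leb2 (disk 1) <= 4%:E)%E.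
  have -> : (4 : R) = (2 * 1) ^+ 2 by ring.
  rewrite -leb2_box//; apply: le_measure; rewrite ?inE.
  - exact: measurable_disk.
  - exact: measurableX.
  - move=> [x y]; rewrite /disk/= !in_itv/= /dot2/= -!expr2 expr1n => h.
    have := sqr_ge0 x; have := sqr_ge0 y.
    by move=> *; split; apply/andP; split; nra.
have lo : (1%:E <= leb2 (disk 1))%E.
  have -> : (1 : R) = (2 * 2^-1) ^+ 2 by field.
  rewrite -leb2_box//; apply: le_measure; rewrite ?inE.
  - exact: measurableX.
  - exact: measurable_disk.
  - move=> [x y]; rewrite /disk/= !in_itv/= /dot2/= -!expr2 => -[/andP[? ?] /andP[? ?]].
    nra.
have fin : leb2 (disk 1) \is a fin_num.
  by rewrite ge0_fin_numE ?(le_lt_trans up) ?ltry// (le_trans _ lo)// lee_fin.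
move: lo; rewrite -(fineK fin) lee_fin => lo.
by exists (fine (leb2 (disk 1))) => //; exact: lt_le_trans ltr01 lo.
Qed.

End DiskVolume.

Section RadialArea.
Context {R : realType}.
Local Notation leb2 := (@lebesgue_measure R \x @lebesgue_measure R)%E.
Variable u : R * R -> R.
Hypotheses (u_smooth : smooth_on setT u) (u_radial : radial u).

Let density (s : R) := expR (2 * ray0 u s).

Let density_cont : continuous density.
Proof.
apply: (@is_derive_continuous _ _ (fun s => density s * (2 * ray1 u s))) => s.
have D := is_derive_ray0 u_smooth s.
by rewrite /density; der; rewrite /=; ring.
Qed.

Let density_even s : density `|s| = density s.
Proof.
congr (expR (2 * _)); apply: u_radial.
by rewrite /dot2/= mulr0 !addr0 -!expr2 real_normK// num_real.
Qed.

Let densityE x : expR (2 * u x) = density (Num.sqrt (dot2 x x)).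
Proof. by rewrite (radialE u_radial). Qed.

Let density_meas (D : set (R * R)) :
  measurable_fun D (fun x => (expR (2 * u x))%:E).
Proof.
apply/measurable_EFinP/measurable_funTS.
rewrite (_ : (fun x => _) = (density \o @Num.sqrt R) \o (fun x => dot2 x x)); last first.
  by apply/funext => x; rewrite densityE.
apply: measurableT_comp; last exact: measurable_dot2.
apply: measurableT_comp; apply: continuous_measurable_fun.
  exact: density_cont.
exact: sqrt_continuous.
Qed.

Lemma area_sub (D D' : set (R * R)) : measurable D -> measurable D' -> D `<=` D' ->
  (area D u <= area D' u)%E.
Proof.
move=> mD mD' DD'; by apply: ge0_subset_integral => //; exact: density_meas.
Qed.

Let disk_sub (a b : R) : a ^+ 2 <= b ^+ 2 -> disk a `<=` disk b.
Proof. by move=> ab x; rewrite /disk/= => /lt_le_trans; apply. Qed.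

(** Monotone convergence along the disks of integral radius. *)
Lemma area_plane_le (B : \bar R) : (forall s : R, 0 < s -> (area (disk s) u <= B)%E) ->
  (area setT u <= B)%E.
Proof.
move=> h.
have U : \bigcup_i (disk (i.+1%:R : R)) = setT.
  apply/seteqP; split => // x _; exists (Num.trunc (dot2 x x)) => //.
  rewrite /disk/=; have d0 : 0 <= dot2 x x by rewrite addr_ge0// -expr2 sqr_ge0.
  have := truncnS_gt (dot2 x x); move: (Num.trunc _) => n hn.
  by apply: (lt_le_trans hn); rewrite expr2 ler_peMr// ?ler1n.
have ndF : {homo (fun n : nat => disk (n.+1%:R : R)) : n m / (n <= m)%N >-> (n <= m)%O}.
  move=> n m nm; apply/subsetPset/disk_sub.
  by rewrite ler_sqr ?nnegrE ?ler0n// ler_nat.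
have mF (n : nat) : measurable (disk (n.+1%:R : R)) by exact: measurable_disk.
have pos (x : R * R) : (0 <= (expR (2 * u x))%:E)%E by rewrite lee_fin expR_ge0.
have cvgA : area (disk n.+1%:R) u @[n --> \oo] --> area setT u.
  rewrite -U; apply: ge0_nondecreasing_set_cvg_integral => // n.
  exact: density_meas.
rewrite -(cvg_lim _ cvgA)//; apply: lime_le; first by apply/cvg_ex; eexists; exact: cvgA.
by near=> n; apply: h; rewrite ltr0n.
Unshelve. all: by end_near. Qed.

Variable C : R.
Hypotheses (C_gt0 : 0 < C) (leb2_C : leb2 (disk 1) = C%:E).

Let vol (s : R) : leb2 (disk s) = (C * s ^+ 2)%:E.
Proof. by rewrite leb2_disk_scale leb2_C -EFinM mulrC. Qed.

Let area_bound (s : R) : exists2 K : R, 0 <= K & (area (disk s) u <= K%:E)%E.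
Proof.
have [c _ cmax] := EVT_max (normr_ge0 s) (continuous_subspaceT density_cont).
exists (density c * (C * s ^+ 2)).
  by rewrite mulr_ge0 ?expR_ge0// mulr_ge0 ?sqr_ge0// ltW.
have -> : (density c * (C * s ^+ 2))%:E =
    (\int[leb2]_(x in disk s) cst (density c)%:E x)%E.
  by rewrite EFinM -vol integral_cst//; exact: measurable_disk.
apply: ge0_le_integral => //.
- exact: measurable_disk.
- exact: density_meas.
- move=> x xs; rewrite lee_fin densityE; apply: cmax.
  rewrite in_itv/= sqrtr_ge0/= -sqrtr_sqr ler_sqrt ?sqr_ge0//.
  exact: ltW.
Qed.

Let area_fin (s : R) : area (disk s) u \is a fin_num.
Proof.
have [K K0 h] := area_bound s; rewrite ge0_fin_numE.
  by rewrite (le_lt_trans h) ?ltry.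
by apply: integral_ge0 => x _; rewrite lee_fin expR_ge0.
Qed.

(** With this normalization the derivative of mass is s e^{2u} when C is the area of
the unit disk. *)
Definition mass (s : R) := fine (area (disk s) u) / (2 * C).

Lemma area_mass s : area (disk s) u = (2 * C * mass s)%:E.
Proof.
by rewrite /mass mulrC divfK ?fineK// ?gt_eqF// mulr_gt0.
Qed.

Lemma mass0 : mass 0 = 0.
Proof.
rewrite /mass /area (_ : disk 0 = set0) ?integral_set0 ?mul0r//.
apply/seteqP; split=> x //=; rewrite /disk/= expr0n/= ltNge.
by rewrite addr_ge0// -expr2 sqr_ge0.
Qed.

Let annulus (a b m M : R) : a ^+ 2 <= b ^+ 2 -> 0 <= m ->
  (forall x, a ^+ 2 <= dot2 x x < b ^+ 2 -> m <= expR (2 * u x) <= M) ->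
  m * (b ^+ 2 - a ^+ 2) <= 2 * (mass b - mass a) <= M * (b ^+ 2 - a ^+ 2).
Proof.
move=> ab m0 mM.
have mA : measurable (disk b `\` disk a) by apply: measurableD; exact: measurable_disk.
have dis : [disjoint disk a & disk b `\` disk a].
  by apply/disj_setPS => x [? []].
have U : disk a `|` (disk b `\` disk a) = disk b.
  by apply: setDUK; exact: disk_sub.
have volA : leb2 (disk b `\` disk a) = (C * (b ^+ 2 - a ^+ 2))%:E.
  have : leb2 (disk b) = (leb2 (disk a) + leb2 (disk b `\` disk a))%E.
    rewrite -[in LHS]U; apply: measureU; [exact: measurable_disk|exact: mA|].
    exact/disj_set2P.
  rewrite !vol.
  have : leb2 (disk b `\` disk a) \is a fin_num.
    rewrite ge0_fin_numE ?measure_ge0//.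
    have sub : (leb2 (disk b `\` disk a) <= leb2 (disk b))%E.
      apply: le_measure; rewrite ?inE.
      - exact: mA.
      - exact: measurable_disk.
      - exact: subDsetl.
    by apply: (le_lt_trans sub); rewrite vol ltry.
  move=> /fineK <-; rewrite -EFinD => -[e]; congr EFin; lra.
have arA : (area (disk b) u = area (disk a) u + area (disk b `\` disk a) u)%E.
  rewrite -{1}U /area ge0_integral_setU//.
  - exact: measurable_disk.
  - exact: density_meas.
have cstA c : (\int[leb2]_(x in disk b `\` disk a) cst c%:E x)%E =
    (C * (c * (b ^+ 2 - a ^+ 2)))%:E.
  rewrite integral_cst//; transitivity (c%:E * (C * (b ^+ 2 - a ^+ 2))%:E)%E.
    by rewrite -volA.
  by rewrite -EFinM; congr EFin; ring.
have inA x : (disk b `\` disk a) x -> m <= expR (2 * u x) <= M.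
  move=> [xb xa]; apply: mM; rewrite xb andbT leNgt; exact/negP.
have arAE : area (disk b `\` disk a) u = (C * (2 * (mass b - mass a)))%:E.
  have : area (disk b `\` disk a) u \is a fin_num.
    rewrite ge0_fin_numE; last by apply: integral_ge0 => x _; rewrite lee_fin expR_ge0.
    apply: le_lt_trans (area_sub mA (measurable_disk b) (@subDsetl _ _ _)) _.
    by rewrite area_mass ltry.
  move: arA; rewrite !area_mass => + /fineK e; rewrite -e -EFinD => -[h].
  by congr EFin; move: h; lra.
apply/andP; split.
- have : (\int[leb2]_(x in disk b `\` disk a) cst m%:E x <= area (disk b `\` disk a) u)%E.
    apply: ge0_le_integral => //; first exact: density_meas.
    by move=> x /inA/andP[+ _]; rewrite lee_fin.
  by rewrite cstA arAE lee_fin ler_pM2l.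
- have : (area (disk b `\` disk a) u <= \int[leb2]_(x in disk b `\` disk a) cst M%:E x)%E.
    apply: ge0_le_integral => //; first exact: density_meas.
    by move=> x /inA/andP[_ +]; rewrite lee_fin.
  by rewrite cstA arAE lee_fin ler_pM2l.
Qed.

Let mass_sqr (s t : R) : s ^+ 2 = t ^+ 2 -> mass s = mass t.
Proof. by move=> e; rewrite /mass /disk e. Qed.

(* On the annulus between the radii s and t the density is within e of its value
   at s. *)
Let mass_diff_near (s e : R) : 0 < e -> \forall t \near s,
  `|2 * (mass t - mass s) - density s * (t ^+ 2 - s ^+ 2)| <= e * `|t ^+ 2 - s ^+ 2|.
Proof.
(* The lower bound density s - e has to be nonnegative to be integrated. *)
wlog es : e / e <= density s.
  move=> H e0; have [es|es] := leP e (density s); first exact: H.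
  have := H _ (lexx _) (expR_gt0 _); apply: filterS => t /le_trans; apply.
  by rewrite ler_wpM2r// ltW.
move=> e0.
have /cvgrPdist_le/(_ e e0) := @density_cont `|s|.
rewrite density_even => /nbhs_ballP[d /= d0 Hd].
have near_s (t x : R) : `|s - t| < d -> Num.min (s ^+ 2) (t ^+ 2) <= x ^+ 2 ->
    x ^+ 2 <= Num.max (s ^+ 2) (t ^+ 2) -> 0 <= x ->
    density s - e <= density x <= density s + e.
  move=> st xm xM x0; have : ball `|s| d x.
    rewrite /ball/= -[x]ger0_norm//.
    apply: le_lt_trans st.
    have sq y : y ^+ 2 = `|y| ^+ 2 :> R by rewrite real_normK// num_real.
    move: xm xM; rewrite ge_min le_max (sq s) (sq t) (sq x).
    have := ler_dist_dist s t; move: (`|s - t|) => D.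
    have s0 := normr_ge0 s; have t0 := normr_ge0 t; have xx0 := normr_ge0 x.
    rewrite !ler_sqr ?nnegrE//; move: (`|s|) (`|t|) (`|x|) s0 t0 xx0.
    move=> s' t' x' s0 t0 xx0; rewrite !ler_norml => /andP[h1 h2].
    by move=> /orP[h3|h3] /orP[h4|h4]; apply/andP; split; lra.
  move=> /Hd; rewrite /= ler_norml => /andP[h1 h2]; apply/andP; split; lra.
apply/nbhs_ballP; exists d => //= t st.
have key (a b : R) : a ^+ 2 <= b ^+ 2 ->
    (forall x, 0 <= x -> a ^+ 2 <= x ^+ 2 -> x ^+ 2 <= b ^+ 2 ->
      density s - e <= density x <= density s + e) ->
    `|2 * (mass b - mass a) - density s * (b ^+ 2 - a ^+ 2)| <= e * `|b ^+ 2 - a ^+ 2|.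
  move=> ab H; have m0 : 0 <= density s - e by rewrite subr_ge0.
  have H' x : a ^+ 2 <= dot2 x x < b ^+ 2 ->
      density s - e <= expR (2 * u x) <= density s + e.
    move=> /andP[ax xb]; rewrite densityE; apply: H => //.
    + by rewrite sqr_sqrtr// (le_trans _ ax)// sqr_ge0.
    + by rewrite sqr_sqrtr ?(ltW xb)// (le_trans _ ax)// sqr_ge0.
  have /andP[h1 h2] := annulus ab m0 H'.
  rewrite (ger0_norm (_ : 0 <= b ^+ 2 - a ^+ 2)) ?subr_ge0//.
  rewrite ler_norml; apply/andP; split; lra.
have [ts|st'] := leP (t ^+ 2) (s ^+ 2).
  have := key t s ts; rewrite -normrN (distrC (s ^+ 2)).
  rewrite (_ : - (_ - _) = 2 * (mass t - mass s) - density s * (t ^+ 2 - s ^+ 2)); last by ring.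
  apply=> x x0 tx xs; apply: (near_s t) => //.
    by rewrite ge_min tx orbT.
  by rewrite le_max xs.
apply: key (ltW st') _ => x x0 sx xt; apply: (near_s t) => //.
  by rewrite ge_min sx.
by rewrite le_max xt orbT.
Qed.

(** Caratheodory's criterion: the quotient psi of 2 (mass t - mass s) by t^2 - s^2 is
a mean of the density over an annulus, hence continuous at s. *)
Lemma is_derive_mass (s : R) : is_derive s 1 mass (s * expR (2 * ray0 u s)).
Proof.
pose psi t := if t ^+ 2 == s ^+ 2 then density s
  else 2 * (mass t - mass s) / (t ^+ 2 - s ^+ 2).
have psiE t : 2 * (mass t - mass s) = psi t * (t ^+ 2 - s ^+ 2).
  rewrite /psi; case: eqP => [e|/eqP ne]; first by rewrite (mass_sqr e) e !subrr !mulr0.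
  by rewrite divfK// subr_eq0.
have psi_cont : {for s, continuous psi}.
  have psis : psi s = density s by rewrite /psi eqxx.
  apply/cvgrPdist_le => e e0.
  apply: filterS (mass_diff_near s e0) => t; rewrite psis psiE -mulrBl normrM distrC.
  have [e'|ne] := eqVneq (t ^+ 2) (s ^+ 2).
    by move=> _; rewrite /psi e' eqxx subrr normr0 ltW.
  by rewrite ler_pM2r// normr_gt0 subr_eq0.
apply/is_derive1_caratheodory; exists (fun t => psi t * ((t + s) / 2)); split.
- move=> t; have := psiE t; have : (t ^+ 2 - s ^+ 2) = (t + s) * (t - s) by ring.
  by move=> -> h; lra.
- apply: (@continuousM R R psi (fun t => (t + s) / 2) s psi_cont).
  apply: (@is_derive_continuous _ _ (fun _ => 2^-1)) => t.
  by der; rewrite /=; ring.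
- by rewrite /psi eqxx /density; field.
Qed.

Lemma mass_profile : profile (ray0 u) (ray1 u) (ray2 u) mass.
Proof.
split; [exact: is_derive_ray0|exact: is_derive_ray1|exact: mass0|exact: is_derive_mass].
Qed.

End RadialArea.

(** * Functions of class C^k in the plane *)

Section CkTheory.
Context {R : realType}.
Implicit Types (D : set (R * R)) (x v : R * R).

Lemma Ck_on_eq (V : normedModType R) k D (f g : R * R -> V) : open D ->
  (forall x, D x -> f x = g x) -> Ck_on k D f -> Ck_on k D g.
Proof.
move=> oD; elim: k f g => [|k IH] f g fg.
  move=> [cf _]; split=> // x Dx.
  have fgx : \forall y \near x, f y = g y by apply: filterS (open_nbhs_nbhs (conj oD Dx)).
  rewrite /prop_for /continuous_at -(fg x Dx); apply: cvg_trans (cf x Dx).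
  by apply: near_eq_cvg; exact: filterS fgx.
move=> [cf [df Ckf1 Ckf2]].
have near_fg x : D x -> \forall y \near x, f y = g y.
  by move=> Dx; apply: filterS (open_nbhs_nbhs (conj oD Dx)).
split.
  move=> x Dx; rewrite /prop_for /continuous_at -(fg x Dx); apply: cvg_trans (cf x Dx).
  by apply: near_eq_cvg; exact: filterS (near_fg x Dx).
split.
- move=> x Dx; have [d1 d2] := df x Dx; split.
    by apply: near_eq_derivable d1; exact: near_fg.
  by apply: near_eq_derivable d2; exact: near_fg.
- apply: IH Ckf1 => x Dx; by apply: near_eq_derive; exact: near_fg.
- apply: IH Ckf2 => x Dx; by apply: near_eq_derive; exact: near_fg.
Qed.

Lemma Ck_on_sub (V : normedModType R) k D D' (f : R * R -> V) :
  D `<=` D' -> Ck_on k D' f -> Ck_on k D f.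
Proof.
move=> DD'; elim: k f => [|k IH] f [cf]; first by split=> // x /DD'; exact: cf.
move=> [df C1 C2]; split; first by move=> x /DD'; exact: cf.
by split; [move=> x /DD'; exact: df|exact: IH|exact: IH].
Qed.

Lemma continuous_rV n (f : R * R -> 'rV[R]_n) x :
  (forall i, {for x, continuous (fun y => f y 0 i)}) -> {for x, continuous f}.
Proof.
move=> cf; apply/cvgrPdist_le => /= e e0; near=> y.
rewrite /Num.Def.normr/= mx_normrE (bigmax_le _ (ltW e0))//= => -[i j] _.
rewrite !mxE/= (ord1 i).
move: j; near: y; apply: filter_forall => /= j.
by have /cvgrPdist_le/(_ e e0) := cf j.
Unshelve. all: by end_near. Qed.

Lemma derive_coord n (f : R * R -> 'rV[R]_n) x v i : derivable f x v ->
  'D_v f x 0 i = 'D_v (fun y => f y 0 i) x.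
Proof. by move=> /derive_mx ->; rewrite mxE. Qed.

Lemma Ck_on_coord n k D (f : R * R -> 'rV[R]_n) : open D ->
  Ck_on k D f <-> forall i, Ck_on k D (fun y => f y 0 i).
Proof.
move=> oD; elim: k f => [|k IH] f.
  split=> [[cf _] i|H]; split; try exact: I; move=> x Dx.
    exact: (continuous_comp (cf x Dx) (@coord_continuous _ _ _ 0 i _)).
  by apply: continuous_rV => i; have [+ _] := H i; exact.
split=> [[cf [df C1 C2]] i|H].
  split=> [x Dx|]; first exact: (continuous_comp (cf x Dx) (@coord_continuous _ _ _ 0 i _)).
  split=> [x Dx||].
  - by have [d1 d2] := df x Dx; split; move/derivable_mxP : d1 d2 => + /derivable_mxP.
  - apply: (Ck_on_eq oD _ ((IH _).1 C1 i)) => x Dx.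
    by rewrite derive_coord//; have [] := df x Dx.
  - apply: (Ck_on_eq oD _ ((IH _).1 C2 i)) => x Dx.
    by rewrite derive_coord//; have [] := df x Dx.
have df x : D x -> derivable f x e1 /\ derivable f x e2.
  move=> Dx; split; apply/derivable_mxP => i j; rewrite (ord1 i).
    by have [_ [dj _ _]] := H j; have [dj1 _] := dj x Dx; exact: dj1.
  by have [_ [dj _ _]] := H j; have [_ dj2] := dj x Dx; exact: dj2.
split=> [x Dx|]; first by apply: continuous_rV => i; have [+ _] := H i; exact.
split=> //; apply/IH => i.
  have [_ [_ C _]] := H i; apply: (Ck_on_eq oD _ C) => x Dx.
  by rewrite derive_coord//; have [] := df x Dx.
have [_ [_ _ C]] := H i; apply: (Ck_on_eq oD _ C) => x Dx.
by rewrite derive_coord//; have [] := df x Dx.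
Qed.

(** The mean value theorem, applied first in one direction and then in the other. *)
Lemma second_difference (f : R * R -> R) (a b d : R) : 0 < d ->
  (forall x y : R, a <= x <= a + d -> b <= y <= b + d ->
     derivable f (x, y) e1 /\ derivable ('D_e1 f) (x, y) e2) ->
  exists x y : R, [/\ a < x < a + d, b < y < b + d &
   f (a + d, b + d) - f (a + d, b) - f (a, b + d) + f (a, b) =
   'D_e2 ('D_e1 f) (x, y) * d * d].
Proof.
move=> d0 df.
have ad : a < a + d by rewrite ltrDl.
have bd : b < b + d by rewrite ltrDl.
have lb : b <= b <= b + d by rewrite lexx ltW.
have ub : b <= b + d <= b + d by rewrite lexx ltW.
have [|x [ax xa e]] := @MVT_on R (fun t => f (t, b + d) - f (t, b))
    (fun t => 'D_e1 f (t, b + d) - 'D_e1 f (t, b)) _ _ ad.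
  move=> t tad; apply: is_derB; apply: is_derive_slice1.
    by have [] := df t (b + d) tad ub.
  by have [] := df t b tad lb.
have [|y [by' yb e']] := @MVT_on R (fun t => 'D_e1 f (x, t))
    (fun t => 'D_e2 ('D_e1 f) (x, t)) _ _ bd.
  have xad : a <= x <= a + d by rewrite !ltW.
  by move=> t tbd; apply: is_derive_slice2; have [] := df x t xad tbd.
exists x, y; split; rewrite ?ax ?by'//.
move: e; rewrite e'.
have -> : a + d - a = d by ring.
have -> : b + d - b = d by ring.
by move=> <-; ring.
Qed.

Lemma second_difference_swap (f : R * R -> R) (a b d : R) : 0 < d ->
  (forall x y : R, a <= x <= a + d -> b <= y <= b + d ->
     derivable f (x, y) e2 /\ derivable ('D_e2 f) (x, y) e1) ->
  exists x y : R, [/\ a < x < a + d, b < y < b + d &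
   f (a + d, b + d) - f (a + d, b) - f (a, b + d) + f (a, b) =
   'D_e1 ('D_e2 f) (x, y) * d * d].
Proof.
move=> d0 df.
have ad : a < a + d by rewrite ltrDl.
have bd : b < b + d by rewrite ltrDl.
have la : a <= a <= a + d by rewrite lexx ltW.
have ua : a <= a + d <= a + d by rewrite lexx ltW.
have [|y [by' yb e]] := @MVT_on R (fun t => f (a + d, t) - f (a, t))
    (fun t => 'D_e2 f (a + d, t) - 'D_e2 f (a, t)) _ _ bd.
  move=> t tbd; apply: is_derB; apply: is_derive_slice2.
    by have [] := df (a + d) t ua tbd.
  by have [] := df a t la tbd.
have [|x [ax xa e']] := @MVT_on R (fun t => 'D_e2 f (t, y))
    (fun t => 'D_e1 ('D_e2 f) (t, y)) _ _ ad.
  have ybd : b <= y <= b + d by rewrite !ltW.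
  by move=> t tad; apply: is_derive_slice1; have [] := df t y tad ybd.
exists x, y; split; rewrite ?ax ?by'//.
move: e; rewrite e'.
have -> : a + d - a = d by ring.
have -> : b + d - b = d by ring.
by move=> <-; ring.
Qed.

Lemma dist_le2 (p q z w e : R) :
  z = w -> `|p - z| <= e / 2 -> `|q - w| <= e / 2 -> `|p - q| <= e.
Proof.
move=> -> h1 h2; rewrite (splitr e) (le_trans (ler_distD w _ _))// lerD//.
by rewrite distrC.
Qed.

(** Both mixed derivatives take the value of the same second difference quotient at
points of an arbitrarily small square. *)
Lemma schwarz (f : R * R -> R) D x : open D -> D x -> Ck_on 2 D f ->
  'D_e2 ('D_e1 f) x = 'D_e1 ('D_e2 f) x.
Proof.
case: x => a b oD Dab [_ [df [_ [df1 _ [c21 _]]] [_ [df2 [c12 _] _]]]].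
apply/eqP; rewrite -subr_eq0 -normr_le0; apply/ler_addgt0Pr => e e0; rewrite add0r.
have eh : 0 < e / 2 by rewrite divr_gt0.
have /nbhs_ballP[d /= d0 Hd] : nbhs (a, b) [set y | [/\ D y,
    `|'D_e2 ('D_e1 f) (a, b) - 'D_e2 ('D_e1 f) y| <= e / 2 &
    `|'D_e1 ('D_e2 f) (a, b) - 'D_e1 ('D_e2 f) y| <= e / 2]].
  have n1 := open_nbhs_nbhs (conj oD Dab).
  have /cvgrPdist_le/(_ _ eh) n2 := c21 _ Dab.
  have /cvgrPdist_le/(_ _ eh) n3 := c12 _ Dab.
  apply: filterS3 n1 n2 n3 => y y1 y2 y3.
  split; [exact: y1|exact: y2|exact: y3].
pose h := d / 2; have h0 : 0 < h by rewrite divr_gt0.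
have box (x y : R) : a <= x <= a + h -> b <= y <= b + h -> ball (a, b) d (x, y).
  move=> /andP[ax xa] /andP[by' yb].
  have hd : h < d by rewrite ltr_pdivrMr// ltr_pMr// ltr1n.
  by split=> /=; rewrite /ball/= ler0_norm ?subr_le0//; lra.
have inb (x y : R) : a <= x <= a + h -> b <= y <= b + h -> D (x, y).
  by move=> xa yb; have [] := Hd _ (box x y xa yb).
have [x [y [xa yb E1]]] := second_difference h0 (fun (x y : R) xa yb =>
  conj (df _ (inb x y xa yb)).1 (df1 _ (inb x y xa yb)).2).
have [x' [y' [xa' yb' E2]]] := second_difference_swap h0 (fun (x y : R) xa yb =>
  conj (df _ (inb x y xa yb)).2 (df2 _ (inb x y xa yb)).1).
have E : 'D_e2 ('D_e1 f) (x, y) = 'D_e1 ('D_e2 f) (x', y').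
  by move: E2; rewrite E1 => /(mulIf (lt0r_neq0 h0))/(mulIf (lt0r_neq0 h0)).
have ltW2 (p q r : R) : p < q < r -> p <= q <= r by move=> /andP[? ?]; rewrite !ltW.
have [_ h1 _] := Hd _ (box x y (ltW2 _ _ _ xa) (ltW2 _ _ _ yb)).
have [_ _ h2] := Hd _ (box x' y' (ltW2 _ _ _ xa') (ltW2 _ _ _ yb')).
exact: (dist_le2 E h1 h2).
Qed.

End CkTheory.

Section SmoothClosure.
Context {R : realType}.
Implicit Types (f g : R * R -> R).

(** A directional derivative is computed along a line. *)
Lemma is_derive_line f (x v : R * R) (d : R) :
  is_derive (0 : R) 1 (fun h : R => f (h *: v + x)) d -> is_derive x v f d.
Proof.
have e : (fun h : R => h^-1 *: ((f \o shift x) (h *: v) - f x)) =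
    (fun h : R => h^-1 *: (((fun h : R => f (h *: v + x)) \o shift 0) (h *: 1)
      - f (0 *: v + x))).
  apply/funext => h /=; congr (_ *: (f _ - f _)); last by rewrite scale0r add0r.
  by rewrite addr0 [_%:A]mulr1.
move=> [d1 d2]; split; first by apply/derivable1P.
by rewrite -d2 /derive e.
Qed.

Lemma Ck_on_pred (V : normedModType R) k D (f : R * R -> V) :
  Ck_on k.+1 D f -> Ck_on k D f.
Proof.
elim: k f => [|k IH] f; first by move=> [].
move=> [cf [df C1 C2]]; split; first exact: cf.
by split; [exact: df|exact: (IH _ C1)|exact: (IH _ C2)].
Qed.

Lemma Ck_cst k (c : R) : Ck_on k setT (cst c : R * R -> R).
Proof.
have D0 (v : R * R) : 'D_v (cst c : R * R -> R) = cst 0.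
  by apply/funext => x; exact: derive_cst.
elim: k c D0 => [|k IH] c D0; split; try exact: I.
- by move=> x _; exact: cst_continuous.
- by move=> x _; exact: cst_continuous.
- split; first by move=> x _; split; exact: derivable_cst.
    by rewrite D0; apply: IH => v; apply/funext => x; exact: derive_cst.
  by rewrite D0; apply: IH => v; apply/funext => x; exact: derive_cst.
Qed.

Lemma is_derive_fst (x v : R * R) : is_derive x v (@fst R R) v.1.
Proof.
apply: is_derive_line => /=.
by der; rewrite /=; ring.
Qed.

Lemma is_derive_snd (x v : R * R) : is_derive x v (@snd R R) v.2.
Proof.
apply: is_derive_line => /=.
by der; rewrite /=; ring.
Qed.

Lemma Ck_fst k : Ck_on k setT (@fst R R).
Proof.
have D0 (v : R * R) : 'D_v (@fst R R) = cst v.1.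
  by apply/funext => x; have [_ e] := is_derive_fst x v; exact: e.
case: k => [|k]; split; try exact: I; try by move=> x _; exact: cvg_fst.
split; first by move=> x _; split; exact: (@ex_derive _ _ _ _ _ _ _ (is_derive_fst x _)).
  by rewrite D0; exact: Ck_cst.
by rewrite D0; exact: Ck_cst.
Qed.

Lemma Ck_snd k : Ck_on k setT (@snd R R).
Proof.
have D0 (v : R * R) : 'D_v (@snd R R) = cst v.2.
  by apply/funext => x; have [_ e] := is_derive_snd x v; exact: e.
case: k => [|k]; split; try exact: I; try by move=> x _; exact: cvg_snd.
split; first by move=> x _; split; exact: (@ex_derive _ _ _ _ _ _ _ (is_derive_snd x _)).
  by rewrite D0; exact: Ck_cst.
by rewrite D0; exact: Ck_cst.
Qed.

Lemma Ck_add k f g : Ck_on k setT f -> Ck_on k setT g -> Ck_on k setT (fun x => f x + g x).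
Proof.
elim: k f g => [|k IH] f g [cf Hf] [cg Hg].
  split; last exact: I.
  by move=> x Dx; exact: (continuousD (cf x Dx) (cg x Dx)).
have [df C1 C2] := Hf; have [dg G1 G2] := Hg.
have DD v : (forall x, derivable f x v) -> (forall x, derivable g x v) ->
    'D_v (fun x => f x + g x) = (fun x => 'D_v f x + 'D_v g x).
  by move=> dfv dgv; apply/funext => x; exact: deriveD.
split; first by move=> x Dx; exact: (continuousD (cf x Dx) (cg x Dx)).
split.
- move=> x _; have [a1 a2] := df x I; have [b1 b2] := dg x I.
  by split; [exact: (derivableD a1 b1)|exact: (derivableD a2 b2)].
- rewrite DD; [exact: (IH _ _ C1 G1)| |].
    by move=> x; have [d _] := df x I; exact: d.
  by move=> x; have [d _] := dg x I; exact: d.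
- rewrite DD; [exact: (IH _ _ C2 G2)| |].
    by move=> x; have [_ d] := df x I; exact: d.
  by move=> x; have [_ d] := dg x I; exact: d.
Qed.

Lemma Ck_mul k f g : Ck_on k setT f -> Ck_on k setT g -> Ck_on k setT (fun x => f x * g x).
Proof.
elim: k f g => [|k IH] f g Cf Cg.
  have [cf _] := Cf; have [cg _] := Cg.
  split; last exact: I.
  by move=> x Dx; exact: (continuousM (cf x Dx) (cg x Dx)).
have [cf [df C1 C2]] := Cf; have [cg [dg G1 G2]] := Cg.
have DD v : (forall x, derivable f x v) -> (forall x, derivable g x v) ->
    'D_v (fun x => f x * g x) = (fun x => f x * 'D_v g x + g x * 'D_v f x).
  by move=> dfv dgv; apply/funext => x; exact: deriveM.
split; first by move=> x Dx; exact: (continuousM (cf x Dx) (cg x Dx)).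
have pf := Ck_on_pred Cf; have pg := Ck_on_pred Cg.
split.
- move=> x _; have [a1 a2] := df x I; have [b1 b2] := dg x I.
  by split; [exact: (derivableM a1 b1)|exact: (derivableM a2 b2)].
- rewrite DD; [exact: (Ck_add (IH _ _ pf G1) (IH _ _ pg C1))| |].
    by move=> x; have [d _] := df x I; exact: d.
  by move=> x; have [d _] := dg x I; exact: d.
- rewrite DD; [exact: (Ck_add (IH _ _ pf G2) (IH _ _ pg C2))| |].
    by move=> x; have [_ d] := df x I; exact: d.
  by move=> x; have [_ d] := dg x I; exact: d.
Qed.

Lemma Ck_inv k f : (forall x, f x != 0) -> Ck_on k setT f ->
  Ck_on k setT (fun x => (f x)^-1).
Proof.
move=> f0; have ci : (forall x, [set: R * R] x -> {for x, continuous f}) ->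
    forall x, [set: R * R] x -> {for x, continuous (fun x => (f x)^-1)}.
  by move=> cf x Dx; apply: (continuousV (f0 x)); exact: (cf x Dx).
elim: k => [|k IH] Cf; first by have [cf _] := Cf; split=> //; exact: ci.
have [cf [df C1 C2]] := Cf.
have DD v : (forall x, derivable f x v) ->
    'D_v (fun x => (f x)^-1) =
    (fun x => cst (- 1) x * (((f x)^-1 * (f x)^-1) * 'D_v f x)).
  move=> dfv; apply/funext => x; apply: (etrans (deriveV (f0 x) (dfv x))).
  rewrite /cst mulN1r; apply: (etrans (mulNr _ _)).
  by rewrite expr2 invfM.
split; first exact: ci.
have Ci := IH (Ck_on_pred Cf).
have Cprod g : Ck_on k setT g ->
    Ck_on k setT (fun x => cst (- 1) x * (((f x)^-1 * (f x)^-1) * g x)).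
  by move=> Cg; apply: Ck_mul; [exact: Ck_cst|exact: Ck_mul (Ck_mul Ci Ci) Cg].
split.
- move=> x _; have [a1 a2] := df x I.
  by split; [exact: (derivableV (f0 x) a1)|exact: (derivableV (f0 x) a2)].
- by rewrite DD; [exact: Cprod|move=> x; have [d _] := df x I; exact: d].
- by rewrite DD; [exact: Cprod|move=> x; have [_ d] := df x I; exact: d].
Qed.

End SmoothClosure.

(** * Conformal maps into the sphere *)

Section Egregium.
Context {R : realType}.

Lemma dot3C (p q : 'rV[R]_3) : dot3 p q = dot3 q p.
Proof. by apply: eq_bigr => i _; rewrite mulrC. Qed.

Lemma dot3E (p q : 'rV[R]_3) : dot3 p q = (p *m q^T) 0 0.
Proof. by rewrite mxE; apply: eq_bigr => i _; rewrite mxE. Qed.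

Lemma dot3Z (c : R) (p q : 'rV[R]_3) : dot3 (c *: p) q = c * dot3 p q.
Proof. by rewrite /dot3 mulr_sumr; apply: eq_bigr => i _; rewrite mxE mulrA. Qed.

Lemma dot3Zr (c : R) (p q : 'rV[R]_3) : dot3 p (c *: q) = c * dot3 p q.
Proof. by rewrite dot3C dot3Z dot3C. Qed.

(** A square matrix with orthonormal rows has orthonormal columns. *)
Lemma parseval3 (b : 'I_3 -> 'rV[R]_3) (v w : 'rV[R]_3) :
  (forall i j, dot3 (b i) (b j) = (i == j)%:R) ->
  dot3 v w = \sum_i dot3 v (b i) * dot3 w (b i).
Proof.
move=> bb; pose B := \matrix_i b i.
have BBT : B *m B^T = 1%:M.
  apply/matrixP => i j; rewrite [RHS]mxE -bb dot3E !mxE.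
  by apply: eq_bigr => k _; rewrite !mxE.
rewrite dot3E -[v in LHS]mulmx1 -(mulmx1C BBT) mulmxA -mulmxA mxE.
apply: eq_bigr => i _; congr (_ * _).
  by rewrite mxE; apply: eq_bigr => k _; rewrite !mxE.
by rewrite mxE; apply: eq_bigr => k _; rewrite !mxE mulrC.
Qed.

Lemma parseval_frame (a X Y v w : 'rV[R]_3) (E : R) : 0 < E ->
  dot3 a a = 1 -> dot3 X X = E -> dot3 Y Y = E ->
  dot3 a X = 0 -> dot3 a Y = 0 -> dot3 X Y = 0 ->
  dot3 v w = dot3 v a * dot3 w a + dot3 v X * dot3 w X / E + dot3 v Y * dot3 w Y / E.
Proof.
move=> E0 aa XX YY aX aY XY.
pose k := (Num.sqrt E)^-1.
have kk : k * k = E^-1 by rewrite -invfM -expr2 sqr_sqrtr// ltW.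
(* The frame a, X, Y normalized. *)
pose b (i : 'I_3) := [:: a; k *: X; k *: Y]`_i.
rewrite (@parseval3 b v w).
  rewrite !big_ord_recl big_ord0 /b/= addr0 addrA !dot3Zr.
  rewrite -kk; ring.
have EE : k * (k * E) = 1 by rewrite mulrA kk mulVf// gt_eqF.
have Xa : dot3 X a = 0 by rewrite dot3C.
have Ya : dot3 Y a = 0 by rewrite dot3C.
have YX : dot3 Y X = 0 by rewrite dot3C.
by move=> [[|[|[|//]]] ?] [[|[|[|//]]] ?]; rewrite /b /= ?dot3Z ?dot3Zr ?aa ?XX ?YY ?aX ?aY
  ?XY ?Xa ?Ya ?YX ?mulr0 ?EE.
Qed.

(** The Gauss equation for a conformal immersion in the unit sphere, in terms of
scalar products at one point: a stands for the immersion, X and Y for its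
partial derivatives, X1, M and Y2 for the second ones, Q for a third one and E,
A, B for the conformal factor and its partial derivatives.  The scalar products
of the second derivatives are expanded in the orthogonal frame a, X, Y, and the
third derivative cancels. *)
Lemma gauss_equation (a X Y X1 M Y2 Q : 'rV[R]_3) (E A B : R) : 0 < E ->
  dot3 a a = 1 -> dot3 X X = E -> dot3 Y Y = E ->
  dot3 a X = 0 -> dot3 a Y = 0 -> dot3 X Y = 0 ->
  dot3 a X1 = - E -> dot3 a M = 0 -> dot3 a Y2 = - E ->
  2 * dot3 X X1 = A -> 2 * dot3 X M = B -> 2 * dot3 Y M = A ->
  2 * dot3 Y Y2 = B -> - 2 * dot3 X1 Y = B -> - 2 * dot3 X Y2 = A ->
  2 * (dot3 M M + dot3 Y Q) + - 2 * (dot3 Q Y + dot3 X1 Y2) =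
  (A ^+ 2 + B ^+ 2) / E - 2 * E ^+ 2.
Proof.
move=> E0 aa XX YY aX aY XY aX1 aM aY2 h1 h2 h3 h4 h5 h6.
rewrite (parseval_frame M M E0 aa XX YY aX aY XY).
rewrite (parseval_frame X1 Y2 E0 aa XX YY aX aY XY).
rewrite !(dot3C _ a) aM aX1 aY2 !(dot3C _ X) (dot3C M Y) (dot3C Y2 Y) (dot3C Q Y).
have E1 : E != 0 by rewrite gt_eqF.
have -> : dot3 X X1 = A / 2 by lra.
have -> : dot3 X M = B / 2 by lra.
have -> : dot3 Y M = A / 2 by lra.
have -> : dot3 Y Y2 = B / 2 by lra.
have -> : dot3 X1 Y = - B / 2 by lra.
have -> : dot3 X Y2 = - A / 2 by lra.
by field.
Qed.

(** Here e = e^{2u}, A and B are the first and p and q the second derivatives of u: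
Delta e^{2u} = 2 e^{2u} (Delta u + 2 |grad u|^2). *)
Lemma liouville_of_log_laplacian (p q A B e L1 L2 dA dB : R) : 0 < e ->
  L1 = 2 * p * e + 4 * A ^+ 2 * e -> L2 = 2 * q * e + 4 * B ^+ 2 * e ->
  dA = 2 * A * e -> dB = 2 * B * e ->
  L1 + L2 = (dA ^+ 2 + dB ^+ 2) / e - 2 * e ^+ 2 -> p + q + e = 0.
Proof.
move=> e0 -> -> -> -> h; have e1 : e != 0 by rewrite gt_eqF.
have : 2 * e * (p + q + e) = 0.
  have h' : ((2 * A * e) ^+ 2 + (2 * B * e) ^+ 2) / e = 4 * A ^+ 2 * e + 4 * B ^+ 2 * e.
    by field.
  by rewrite h' in h; lra.
by move/eqP; rewrite !mulf_eq0 pnatr_eq0 (negbTE e1) => /eqP.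
Qed.

Lemma is_derive_dot3 (P Q : R * R -> 'rV[R]_3) (x v : R * R) :
  derivable P x v -> derivable Q x v ->
  is_derive x v (fun y => dot3 (P y) (Q y))
    (dot3 ('D_v P x) (Q x) + dot3 (P x) ('D_v Q x)).
Proof.
move=> dP dQ.
have cP i : is_derive x v (fun y => P y 0 i) ('D_v P x 0 i).
  by rewrite derive_coord//; apply/derivableP; move/derivable_mxP : dP => /(_ 0 i).
have cQ i : is_derive x v (fun y => Q y 0 i) ('D_v Q x 0 i).
  by rewrite derive_coord//; apply/derivableP; move/derivable_mxP : dQ => /(_ 0 i).
have -> : (fun y => dot3 (P y) (Q y)) = \sum_i ((fun y => P y 0 i) * (fun y => Q y 0 i)).
  by apply/funext => y; rewrite /dot3 fct_sumE.
have -> : dot3 ('D_v P x) (Q x) + dot3 (P x) ('D_v Q x) =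
    \sum_i (P x 0 i *: 'D_v Q x 0 i + Q x 0 i *: 'D_v P x 0 i).
  rewrite /dot3 -big_split/=; apply: eq_bigr => i _.
  by rewrite addrC; congr (_ + _); rewrite mulrC.
apply: is_derive_sum => i; exact: is_deriveM.
Qed.

Lemma schwarz_rV (f : R * R -> 'rV[R]_3) D x : open D -> D x -> Ck_on 2 D f ->
  'D_e2 ('D_e1 f) x = 'D_e1 ('D_e2 f) x.
Proof.
move=> oD Dx Cf; apply/rowP => i.
have [_ [df [_ [df1 _ _]] [_ [df2 _ _]]]] := Cf.
have [_ d12] := df1 x Dx; have [d21 _] := df2 x Dx.
have nD : \forall y \near x, D y by exact: open_nbhs_nbhs.
have E1 : 'D_e2 ('D_e1 f) x 0 i = 'D_e2 ('D_e1 (fun y => f y 0 i)) x.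
  apply: (etrans (derive_coord i d12)); apply: near_eq_derive.
  by apply: filterS nD => y Dy; apply: derive_coord; have [] := df y Dy.
have E2 : 'D_e1 ('D_e2 f) x 0 i = 'D_e1 ('D_e2 (fun y => f y 0 i)) x.
  apply: (etrans (derive_coord i d21)); apply: near_eq_derive.
  by apply: filterS nD => y Dy; apply: derive_coord; have [] := df y Dy.
apply: (etrans E1); apply: (etrans _ (esym E2)).
exact: (schwarz oD Dx ((Ck_on_coord 2 f oD).1 Cf i)).
Qed.

Lemma open_disk (r : R) : open (disk r).
Proof.
have cd : continuous (fun x : R * R => dot2 x x).
  move=> x.
  have c1 : {for x, continuous (@fst R R)} by exact: cvg_fst.
  have c2 : {for x, continuous (@snd R R)} by exact: cvg_snd.
  exact: (continuousD (continuousM c1 c1) (continuousM c2 c2)).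
rewrite (_ : disk r = (fun x => dot2 x x) @^-1` [set t | t < r ^+ 2])//.
by apply: open_comp; [move=> x _; exact: cd|exact: open_lt].
Qed.

Variables (u : R * R -> R) (D : set (R * R)) (phi : R * R -> 'rV[R]_3).
Hypotheses (u_smooth : smooth_on setT u) (oD : open D) (phi_smooth : smooth_on D phi).
Hypothesis phi_sphere : forall x, D x -> dot3 (phi x) (phi x) = 1.
Hypothesis phi_metric : forall x, D x -> forall v w : R * R,
  dot3 ('D_v phi x) ('D_w phi x) = expR (2 * u x) * dot2 v w.

Let E x := expR (2 * u x).
Let X := 'D_e1 phi.
Let Y := 'D_e2 phi.
Let M := 'D_e2 X.

Let E_pos x : 0 < E x. Proof. exact: expR_gt0. Qed.

Let dphi x : D x -> derivable phi x e1 /\ derivable phi x e2.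
Proof. by move=> Dx; have [_ [/(_ x Dx)]] := phi_smooth 1. Qed.
Let dX x : D x -> derivable X x e1 /\ derivable X x e2.
Proof. by move=> Dx; have [_ [_ [_ [/(_ x Dx)]]]] := phi_smooth 2. Qed.
Let dY x : D x -> derivable Y x e1 /\ derivable Y x e2.
Proof. by move=> Dx; have [_ [_ _ [_ [/(_ x Dx)]]]] := phi_smooth 2. Qed.
Let dX1 x : D x -> derivable ('D_e1 X) x e1 /\ derivable ('D_e1 X) x e2.
Proof. by move=> Dx; have [_ [_ [_ [_ [_ [/(_ x Dx)]]]]]] := phi_smooth 3. Qed.
Let dM x : D x -> derivable M x e1 /\ derivable M x e2.
Proof. by move=> Dx; have [_ [_ [_ [_ _ [_ [/(_ x Dx)]]]]]] := phi_smooth 3. Qed.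

Let MY x : D x -> 'D_e1 Y x = M x.
Proof. by move=> Dx; exact: esym (schwarz_rV oD Dx (phi_smooth 2)). Qed.

Let MX x : D x -> 'D_e1 M x = 'D_e2 ('D_e1 X) x.
Proof.
move=> Dx; have [_ [_ CX _]] := phi_smooth 3.
exact: esym (schwarz_rV oD Dx CX).
Qed.

Let derive_const_dot (P Q : R * R -> 'rV[R]_3) (v : R * R) (g : R * R -> R) x : D x ->
  (forall y, D y -> dot3 (P y) (Q y) = g y) ->
  derivable P x v -> derivable Q x v ->
  dot3 ('D_v P x) (Q x) + dot3 (P x) ('D_v Q x) = 'D_v g x.
Proof.
move=> Dx h dP dQ; have [_ <-] := is_derive_dot3 dP dQ.
apply: near_eq_derive.
by apply: filterS (open_nbhs_nbhs (conj oD Dx)).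
Qed.

Let XX x : D x -> dot3 (X x) (X x) = E x.
Proof.
move=> Dx; apply: (etrans (phi_metric Dx e1 e1)).
by rewrite -/(E x) /dot2 /=; ring.
Qed.
Let YY x : D x -> dot3 (Y x) (Y x) = E x.
Proof.
move=> Dx; apply: (etrans (phi_metric Dx e2 e2)).
by rewrite -/(E x) /dot2 /=; ring.
Qed.
Let XY x : D x -> dot3 (X x) (Y x) = 0.
Proof.
move=> Dx; apply: (etrans (phi_metric Dx e1 e2)).
by rewrite -/(E x) /dot2 /=; ring.
Qed.

Let derive_dot0 (P Q : R * R -> 'rV[R]_3) (v : R * R) (c : R) x : D x ->
  (forall y, D y -> dot3 (P y) (Q y) = c) ->
  derivable P x v -> derivable Q x v ->
  dot3 ('D_v P x) (Q x) = - dot3 (P x) ('D_v Q x).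
Proof.
move=> Dx h dP dQ; apply/eqP; rewrite -addr_eq0.
by rewrite (derive_const_dot (g := cst c) Dx h dP dQ) derive_cst.
Qed.

Let derive_norm2 (P : R * R -> 'rV[R]_3) (v : R * R) (g : R * R -> R) x : D x ->
  (forall y, D y -> dot3 (P y) (P y) = g y) -> derivable P x v ->
  2 * dot3 (P x) ('D_v P x) = 'D_v g x.
Proof.
move=> Dx h dP; rewrite -(derive_const_dot Dx h dP dP) (dot3C ('D_v P x)).
by rewrite mulr2n mulrDl !mul1r.
Qed.

Let derive_unit (v : R * R) x : D x -> derivable phi x v -> dot3 (phi x) ('D_v phi x) = 0.
Proof.
move=> Dx d; have h := derive_norm2 (g := cst 1) Dx phi_sphere d.
by move/eqP: h; rewrite derive_cst mulf_eq0 pnatr_eq0 => /eqP.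
Qed.

Let aX x : D x -> dot3 (phi x) (X x) = 0.
Proof. by move=> Dx; have [d1 _] := dphi Dx; exact: derive_unit. Qed.
Let aY x : D x -> dot3 (phi x) (Y x) = 0.
Proof. by move=> Dx; have [_ d1] := dphi Dx; exact: derive_unit. Qed.

Let aX1 x : D x -> dot3 (phi x) ('D_e1 X x) = - E x.
Proof.
move=> Dx; have [d1 _] := dphi Dx; have [d2 _] := dX Dx.
by apply: oppr_inj; rewrite -(derive_dot0 Dx aX d1 d2) opprK (XX Dx).
Qed.
Let aM x : D x -> dot3 (phi x) (M x) = 0.
Proof.
move=> Dx; have [_ d1] := dphi Dx; have [_ d2] := dX Dx.
by apply: oppr_inj; rewrite -(derive_dot0 Dx aX d1 d2) oppr0 dot3C (XY Dx).
Qed.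
Let aY2 x : D x -> dot3 (phi x) ('D_e2 Y x) = - E x.
Proof.
move=> Dx; have [_ d1] := dphi Dx; have [_ d2] := dY Dx.
by apply: oppr_inj; rewrite -(derive_dot0 Dx aY d1 d2) opprK (YY Dx).
Qed.

Let XX1 x : D x -> 2 * dot3 (X x) ('D_e1 X x) = 'D_e1 E x.
Proof. by move=> Dx; have [d1 _] := dX Dx; exact: (derive_norm2 Dx XX d1). Qed.
Let XM x : D x -> 2 * dot3 (X x) (M x) = 'D_e2 E x.
Proof. by move=> Dx; have [_ d1] := dX Dx; exact: (derive_norm2 Dx XX d1). Qed.
Let YM x : D x -> 2 * dot3 (Y x) (M x) = 'D_e1 E x.
Proof.
by move=> Dx; have [d1 _] := dY Dx; rewrite -(MY Dx); exact: (derive_norm2 Dx YY d1).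
Qed.
Let YY2 x : D x -> 2 * dot3 (Y x) ('D_e2 Y x) = 'D_e2 E x.
Proof. by move=> Dx; have [_ d1] := dY Dx; exact: (derive_norm2 Dx YY d1). Qed.
Let X1Y x : D x -> - 2 * dot3 ('D_e1 X x) (Y x) = 'D_e2 E x.
Proof.
move=> Dx; have [d1 _] := dX Dx; have [d2 _] := dY Dx.
by rewrite (derive_dot0 Dx XY d1 d2) mulrNN (MY Dx) (XM Dx).
Qed.
Let XY2 x : D x -> - 2 * dot3 (X x) ('D_e2 Y x) = 'D_e1 E x.
Proof.
move=> Dx; have [_ d1] := dX Dx; have [_ d2] := dY Dx.
rewrite mulNr -mulrN -(derive_dot0 Dx XY d1 d2) dot3C.
exact: (YM Dx).
Qed.

Let derive_scaled (k : R) (P Q : R * R -> 'rV[R]_3) (v : R * R) (g : R * R -> R) x :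
  D x -> k != 0 -> (forall y, D y -> k * dot3 (P y) (Q y) = g y) ->
  derivable P x v -> derivable Q x v ->
  'D_v g x = k * (dot3 ('D_v P x) (Q x) + dot3 (P x) ('D_v Q x)).
Proof.
move=> Dx k0 h dP dQ; have dPQ := is_derive_dot3 dP dQ.
have [dd <-] := dPQ.
have e := deriveZ k dd.
have -> : 'D_v g x = 'D_v (k \*: (fun y => dot3 (P y) (Q y))) x.
  apply: near_eq_derive; apply: filterS (open_nbhs_nbhs (conj oD Dx)) => y Dy.
  exact: esym (h y Dy).
by rewrite e.
Qed.

Let E22 x : D x -> 'D_e2 ('D_e2 E) x =
  - 2 * (dot3 ('D_e2 ('D_e1 X) x) (Y x) + dot3 ('D_e1 X x) ('D_e2 Y x)).
Proof.
move=> Dx; have [_ d1] := dX1 Dx; have [_ d2] := dY Dx.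
have k0 : - 2 != 0 :> R by rewrite oppr_eq0 pnatr_eq0.
exact: (derive_scaled Dx k0 X1Y d1 d2).
Qed.

Let E11 x : D x -> 'D_e1 ('D_e1 E) x =
  2 * (dot3 (M x) (M x) + dot3 (Y x) ('D_e2 ('D_e1 X) x)).
Proof.
move=> Dx; have [d1 _] := dY Dx; have [d2 _] := dM Dx.
have k0 : 2 != 0 :> R by rewrite pnatr_eq0.
have h := derive_scaled Dx k0 YM d1 d2.
by rewrite -(MX Dx) -[in dot3 (M x)](MY Dx).
Qed.

Let metric_laplacian x : D x ->
  'D_e1 ('D_e1 E) x + 'D_e2 ('D_e2 E) x =
  ('D_e1 E x ^+ 2 + 'D_e2 E x ^+ 2) / E x - 2 * E x ^+ 2.
Proof.
move=> Dx; apply: (etrans (congr2 +%R (E11 Dx) (E22 Dx))).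
exact: (gauss_equation _ (E_pos x) (phi_sphere Dx) (XX Dx) (YY Dx) (aX Dx) (aY Dx)
  (XY Dx) (aX1 Dx) (aM Dx) (aY2 Dx) (XX1 Dx) (XM Dx) (YM Dx) (YY2 Dx) (X1Y Dx) (XY2 Dx)).
Qed.

Let is_derive_E1 (a b : R) :
  is_derive a 1 (fun t => E (t, b)) (2 * 'D_e1 u (a, b) * E (a, b)).
Proof.
have [_ [d0 _ _]] := u_smooth 1; have [d1 _] := d0 (a, b) I.
have D1 := is_derive_slice1 d1.
by rewrite /E; der; rewrite /=; ring.
Qed.

Let is_derive_E2 (a b : R) :
  is_derive b 1 (fun t => E (a, t)) (2 * 'D_e2 u (a, b) * E (a, b)).
Proof.
have [_ [d0 _ _]] := u_smooth 1; have [_ d1] := d0 (a, b) I.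
have D1 := is_derive_slice2 d1.
by rewrite /E; der; rewrite /=; ring.
Qed.

Let D1E : 'D_e1 E = fun x => 2 * 'D_e1 u x * E x.
Proof.
apply/funext => -[a b]; rewrite derive_slice1; have [_ e] := is_derive_E1 a b; exact: e.
Qed.

Let D2E : 'D_e2 E = fun x => 2 * 'D_e2 u x * E x.
Proof.
apply/funext => -[a b]; rewrite derive_slice2; have [_ e] := is_derive_E2 a b; exact: e.
Qed.

Let D11E x : 'D_e1 ('D_e1 E) x = 2 * 'D_e1 ('D_e1 u) x * E x + 4 * 'D_e1 u x ^+ 2 * E x.
Proof.
case: x => a b; rewrite D1E derive_slice1.
have [_ [_ [_ [d0 _ _]] _]] := u_smooth 2; have [d1 _] := d0 (a, b) I.
have D1 := is_derive_slice1 d1; have D2 := is_derive_E1 a b.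
have D3 : is_derive a 1 (fun t => 2 * 'D_e1 u (t, b) * E (t, b))
  (2 * 'D_e1 ('D_e1 u) (a, b) * E (a, b) + 4 * 'D_e1 u (a, b) ^+ 2 * E (a, b)).
  by der; rewrite /=; ring.
by have [_ e] := D3; exact: e.
Qed.

Let D22E x : 'D_e2 ('D_e2 E) x = 2 * 'D_e2 ('D_e2 u) x * E x + 4 * 'D_e2 u x ^+ 2 * E x.
Proof.
case: x => a b; rewrite D2E derive_slice2.
have [_ [_ _ [_ [d0 _ _]]]] := u_smooth 2; have [_ d1] := d0 (a, b) I.
have D1 := is_derive_slice2 d1; have D2 := is_derive_E2 a b.
have D3 : is_derive b 1 (fun t => 2 * 'D_e2 u (a, t) * E (a, t))
  (2 * 'D_e2 ('D_e2 u) (a, b) * E (a, b) + 4 * 'D_e2 u (a, b) ^+ 2 * E (a, b)).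
  by der; rewrite /=; ring.
by have [_ e] := D3; exact: e.
Qed.

(** The metric determines the curvature: the Laplacian of the conformal factor is
computed from the immersion by differentiating the metric relations, the
symmetry of mixed derivatives being used for phi and for 'D_e1 phi. *)
Lemma theorema_egregium x : D x -> laplacian u x + expR (2 * u x) = 0.
Proof.
move=> Dx; exact: (liouville_of_log_laplacian (E_pos x) (D11E x) (D22E x)
  (congr1 (fun f => f x) D1E) (congr1 (fun f => f x) D2E) (metric_laplacian Dx)).
Qed.

End Egregium.

(** * Stereographic projection *)

Section Stereographic.
Context {R : realType}.
Variables (l r sg : R).
Hypotheses (l0 : 0 < l) (r0 : 0 < r) (sg2 : sg * sg = 1).

Definition north : 'rV[R]_3 := \row_i [:: 0; 0; 1]`_i.

(** Inverse stereographic projection from the pole opposite to sg *: north, after a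
dilation of ratio l; sg is 1 or -1. *)
Definition stereo (x : R * R) : 'rV[R]_3 := \row_i
  [:: 2 * l * x.1 / (1 + l ^+ 2 * dot2 x x);
      2 * l * x.2 / (1 + l ^+ 2 * dot2 x x);
      sg * (1 - l ^+ 2 * dot2 x x) / (1 + l ^+ 2 * dot2 x x)]`_i.

Let i0 : 'I_3 := ord0.
Let i1 : 'I_3 := lift ord0 ord0.
Let i2 : 'I_3 := lift ord0 (lift ord0 ord0).

Let ord3P (P : 'I_3 -> Prop) : P i0 -> P i1 -> P i2 -> forall i, P i.
Proof.
move=> h0 h1 h2 [[|[|[|//]]] h].
- by rewrite (_ : Ordinal h = i0)//; apply: val_inj.
- by rewrite (_ : Ordinal h = i1)//; apply: val_inj.
- by rewrite (_ : Ordinal h = i2)//; apply: val_inj.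
Qed.

Let dot3_expand (p q : 'rV[R]_3) : dot3 p q = p 0 i0 * q 0 i0 + p 0 i1 * q 0 i1 + p 0 i2 * q 0 i2.
Proof. by rewrite /dot3 !big_ord_recl big_ord0 addr0 addrA. Qed.

Let den x := 1 + l ^+ 2 * dot2 x x.
Let den_gt0 (x : R * R) : 0 < den x.
Proof.
have d0 : 0 <= dot2 x x by rewrite addr_ge0// -expr2 sqr_ge0.
by rewrite ltr_pwDl// mulr_ge0// sqr_ge0.
Qed.
Let den_neq0 (x : R * R) : den x != 0. Proof. by rewrite gt_eqF. Qed.

Let stereo0 x : stereo x 0 i0 = 2 * l * x.1 / den x. Proof. by rewrite mxE. Qed.
Let stereo1 x : stereo x 0 i1 = 2 * l * x.2 / den x. Proof. by rewrite mxE. Qed.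
Let stereo2 x : stereo x 0 i2 = sg * (1 - l ^+ 2 * dot2 x x) / den x.
Proof. by rewrite mxE. Qed.

Lemma stereo_smooth : smooth_on setT stereo.
Proof.
move=> k; apply/Ck_on_coord; first exact: openT.
have C1 := @Ck_fst R k; have C2 := @Ck_snd R k.
have Cdot : Ck_on k setT (fun x : R * R => dot2 x x).
  exact: Ck_add (Ck_mul C1 C1) (Ck_mul C2 C2).
have Cl (c : R) (f : R * R -> R) : Ck_on k setT f -> Ck_on k setT (fun x => c * f x).
  by move=> Cf; exact: (Ck_mul (Ck_cst k c) Cf).
have Cden : Ck_on k setT den by exact: (Ck_add (Ck_cst k 1) (Cl _ _ Cdot)).
have Cinv := Ck_inv den_neq0 Cden.
apply: ord3P.
- rewrite (_ : (fun y => _) = (fun x => 2 * l * x.1 * (den x)^-1)); last first.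
    by apply/funext => x; rewrite stereo0.
  exact: (Ck_mul (Cl _ _ C1) Cinv).
- rewrite (_ : (fun y => _) = (fun x => 2 * l * x.2 * (den x)^-1)); last first.
    by apply/funext => x; rewrite stereo1.
  exact: (Ck_mul (Cl _ _ C2) Cinv).
- rewrite (_ : (fun y => _) = (fun x => sg * (1 + (- l ^+ 2) * dot2 x x) * (den x)^-1)); last first.
    by apply/funext => x; rewrite stereo2 mulNr.
  exact: (Ck_mul (Cl _ _ (Ck_add (Ck_cst k 1) (Cl _ _ Cdot))) Cinv).
Qed.

Let denl (a b c d h : R) := 1 + l ^+ 2 * ((h * c + a) ^+ 2 + (h * d + b) ^+ 2).

Let is_derive_denl (a b c d : R) : is_derive (0 : R) 1 (denl a b c d)
  (2 * l ^+ 2 * (a * c + b * d)).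
Proof. by rewrite /denl; der; rewrite /=; ring. Qed.

Let denlE (a b c d h : R) : den (h *: (c, d) + (a, b)) = denl a b c d h.
Proof. by rewrite /den /denl !expr2. Qed.

Let denl0 (a b c d : R) : denl a b c d 0 = den (a, b).
Proof. by rewrite /den /denl /dot2 /= !mul0r !add0r !expr2. Qed.

Let is_derive_denlV (a b c d : R) : is_derive (0 : R) 1 (fun h => (denl a b c d h)^-1)
  (- (den (a, b)) ^- 2 * (2 * l ^+ 2 * (a * c + b * d))).
Proof.
have := @is_derV R (denl a b c d) 0 (2 * l ^+ 2 * (a * c + b * d)).
by rewrite denl0; apply; [exact: den_neq0|exact: is_derive_denl].
Qed.

Let is_derive_stereo0 x v : is_derive x v (fun y => stereo y 0 i0)
  (2 * l * (v.1 * den x - x.1 * (2 * l ^+ 2 * dot2 x v)) / den x ^+ 2).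
Proof.
case: x v => [a b] [c d]; apply: is_derive_line.
have -> : (fun h : R => stereo (h *: (c, d) + (a, b)) 0 i0) =
    (fun h => 2 * l * (h * c + a) * (denl a b c d h)^-1).
  by apply/funext => h; rewrite stereo0 denlE.
have DV := is_derive_denlV a b c d.
der; rewrite /= denl0 /dot2 /=.
by have := den_neq0 (a, b); move: (den _) => p p0; field.
Qed.

Let is_derive_stereo1 x v : is_derive x v (fun y => stereo y 0 i1)
  (2 * l * (v.2 * den x - x.2 * (2 * l ^+ 2 * dot2 x v)) / den x ^+ 2).
Proof.
case: x v => [a b] [c d]; apply: is_derive_line.
have -> : (fun h : R => stereo (h *: (c, d) + (a, b)) 0 i1) =
    (fun h => 2 * l * (h * d + b) * (denl a b c d h)^-1).
  by apply/funext => h; rewrite stereo1 denlE.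
have DV := is_derive_denlV a b c d.
der; rewrite /= denl0 /dot2 /=.
by have := den_neq0 (a, b); move: (den _) => p p0; field.
Qed.

Let is_derive_stereo2 x v : is_derive x v (fun y => stereo y 0 i2)
  (- sg * (4 * l ^+ 2 * dot2 x v) / den x ^+ 2).
Proof.
case: x v => [a b] [c d]; apply: is_derive_line.
have -> : (fun h : R => stereo (h *: (c, d) + (a, b)) 0 i2) =
    (fun h => sg * (2 * (denl a b c d h)^-1 - 1)).
  apply/funext => h; rewrite stereo2 denlE.
  have := den_neq0 (h *: (c, d) + (a, b)); rewrite denlE => p0.
  have -> : l ^+ 2 * dot2 (h *: (c, d) + (a, b)) (h *: (c, d) + (a, b)) =
    denl a b c d h - 1 by rewrite -denlE /den; ring.
  by field.
have DV := is_derive_denlV a b c d.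
der; rewrite /= denl0 /dot2 /=.
by have := den_neq0 (a, b); move: (den _) => p p0; field.
Qed.

Lemma stereo_conformal (x v w : R * R) : dot3 ('D_v stereo x) ('D_w stereo x) =
  (2 * l / (1 + l ^+ 2 * dot2 x x)) ^+ 2 * dot2 v w.
Proof.
have D z : derivable stereo x z.
  apply/derivable_mxP => i j; rewrite (ord1 i); move: j; apply: ord3P.
  - exact: (@ex_derive _ _ _ _ _ _ _ (is_derive_stereo0 x z)).
  - exact: (@ex_derive _ _ _ _ _ _ _ (is_derive_stereo1 x z)).
  - exact: (@ex_derive _ _ _ _ _ _ _ (is_derive_stereo2 x z)).
have E0 z := etrans (derive_coord i0 (D z)) (@derive_val _ _ _ _ _ _ _ (is_derive_stereo0 x z)).
have E1 z := etrans (derive_coord i1 (D z)) (@derive_val _ _ _ _ _ _ _ (is_derive_stereo1 x z)).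
have E2 z := etrans (derive_coord i2 (D z)) (@derive_val _ _ _ _ _ _ _ (is_derive_stereo2 x z)).
apply: (etrans (etrans (dot3_expand _ _) (congr2 +%R (congr2 +%R
  (congr2 *%R (E0 v) (E0 w)) (congr2 *%R (E1 v) (E1 w))) (congr2 *%R (E2 v) (E2 w))))).
rewrite -/(den x).
have : den x = 1 + l ^+ 2 * dot2 x x by [].
have := den_neq0 x; move: (den x) => p; rewrite /dot2 => p0 pE.
case: x v w pE {D E0 E1 E2} => [a b] [c d] [c' d'] /= pE.
have S : sg ^+ 2 = 1 by rewrite expr2.
have -> : - sg * (4 * l ^+ 2 * (a * c + b * d)) / p ^+ 2 *
  (- sg * (4 * l ^+ 2 * (a * c' + b * d')) / p ^+ 2) =
  16 * l ^+ 4 * (a * c + b * d) * (a * c' + b * d') / p ^+ 4.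
  transitivity (sg ^+ 2 * (16 * l ^+ 4 * (a * c + b * d) * (a * c' + b * d') / p ^+ 4)).
    by field.
  by rewrite S mul1r.
apply/eqP; rewrite -subr_eq0; apply/eqP.
transitivity (16 * l ^+ 4 * (a * c + b * d) * (a * c' + b * d') *
   (1 + l ^+ 2 * (a * a + b * b) - p) / p ^+ 4); first by field.
by rewrite pE subrr mulr0 mul0r.
Qed.

Lemma stereo_sphere x : dot3 (stereo x) (stereo x) = 1.
Proof.
rewrite dot3_expand stereo0 stereo1 stereo2.
have pE : den x = 1 + l ^+ 2 * dot2 x x by [].
have := den_neq0 x; move: (den x) pE => p; rewrite /dot2 => pE p0.
have -> : sg * (1 - l ^+ 2 * (x.1 * x.1 + x.2 * x.2)) / p *
  (sg * (1 - l ^+ 2 * (x.1 * x.1 + x.2 * x.2)) / p) =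
  ((2 - p) / p) ^+ 2.
  transitivity ((sg * sg) * ((2 - p) / p) ^+ 2); last by rewrite sg2 mul1r.
  by rewrite pE; field; rewrite -pE.
transitivity ((4 * (p - 1) + (2 - p) ^+ 2) / p ^+ 2); last by field.
have -> : 4 * (p - 1) = 4 * l ^+ 2 * (x.1 * x.1 + x.2 * x.2) by rewrite pE; ring.
by field.
Qed.

Let height x := (1 - l ^+ 2 * dot2 x x) / den x.

Lemma stereo_height x : dot3 (sg *: north) (stereo x) = height x.
Proof.
rewrite dot3_expand stereo0 stereo1 stereo2 !mxE /= !mulr0 !mul0r !add0r mulr1.
by rewrite /height !mulrA sg2 mul1r.
Qed.

Definition cap_cos := (1 - l ^+ 2 * r ^+ 2) / (1 + l ^+ 2 * r ^+ 2).

Lemma cap_cos_bound : -1 < cap_cos < 1.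
Proof.
have lr : 0 < l ^+ 2 * r ^+ 2 by rewrite mulr_gt0// exprn_gt0.
have p0 : 0 < 1 + l ^+ 2 * r ^+ 2 by rewrite addr_gt0.
rewrite /cap_cos ltr_pdivlMr// ltr_pdivrMr//; apply/andP; split; lra.
Qed.

Let height_disk x : (cap_cos < height x) = (dot2 x x < r ^+ 2).
Proof.
have lr : 0 < l ^+ 2 * r ^+ 2 by rewrite mulr_gt0// exprn_gt0.
have p0 : 0 < 1 + l ^+ 2 * r ^+ 2 by rewrite addr_gt0.
have l2 : 0 < l ^+ 2 by rewrite exprn_gt0.
rewrite /cap_cos /height ltr_pdivrMr// [_ / _ * _]mulrAC ltr_pdivlMr// /den.
rewrite -(ltr_pM2l l2 _ (r ^+ 2)); apply/idP/idP; lra.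
Qed.

Let acos_lt (z : R) : -1 <= z <= 1 -> (acos z < acos cap_cos) = (cap_cos < z).
Proof.
move=> z1; have /andP[c1 c2] := cap_cos_bound.
have cI : -1 <= cap_cos <= 1 by rewrite !ltW.
rewrite -ltr_cos ?in_itv/= ?acos_ge0 ?acos_lepi// !acosK// in_itv/=.
Qed.

Let sphere_bound (q : 'rV[R]_3) : dot3 q q = 1 -> -1 <= dot3 (sg *: north) q <= 1.
Proof.
rewrite !dot3_expand !mxE /= !mulr0 !mul0r !add0r mulr1 => h.
have : (sg * q 0 i2) ^+ 2 <= 1.
  rewrite expr2 mulrACA sg2 mul1r -h lerDr addr_ge0// -expr2 sqr_ge0//.
by move=> h'; rewrite -ler_norml -(@expr_le1 _ 2)// real_normK// num_real.
Qed.

Let stereo_inv (q : 'rV[R]_3) : R * R :=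
  (q 0 i0 / (l * (1 + sg * q 0 i2)), q 0 i1 / (l * (1 + sg * q 0 i2))).

Let stereo_invK (q : 'rV[R]_3) : dot3 q q = 1 -> -1 < sg * q 0 i2 ->
  stereo (stereo_inv q) = q.
Proof.
rewrite dot3_expand => qq z1.
have n0 : 1 + sg * q 0 i2 != 0 by rewrite gt_eqF//; lra.
have l1 : l != 0 by rewrite gt_eqF.
have d : l ^+ 2 * dot2 (stereo_inv q) (stereo_inv q) =
    (1 - sg * q 0 i2) / (1 + sg * q 0 i2).
  have e : q 0 i0 * q 0 i0 + q 0 i1 * q 0 i1 = (1 - sg * q 0 i2) * (1 + sg * q 0 i2).
    transitivity (1 - sg * sg * (q 0 i2 * q 0 i2)); last by ring.
    by rewrite sg2 mul1r -qq; ring.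
  transitivity ((q 0 i0 * q 0 i0 + q 0 i1 * q 0 i1) / (1 + sg * q 0 i2) ^+ 2).
    by rewrite /dot2 /stereo_inv /=; field; rewrite n0 l1.
  by rewrite e; field.
have p : den (stereo_inv q) = 2 / (1 + sg * q 0 i2).
  by rewrite /den d; field.
apply/rowP; apply: ord3P.
- by rewrite stereo0 p /=; field; rewrite n0 l1.
- by rewrite stereo1 p /=; field; rewrite n0 l1.
- rewrite stereo2 p d; transitivity (sg * sg * q 0 i2); last by rewrite sg2 mul1r.
  by field.
Qed.

Let stereoK x : stereo_inv (stereo x) = x.
Proof.
have l1 : l != 0 by rewrite gt_eqF.
rewrite /stereo_inv stereo0 stereo1 stereo2.
have -> : 1 + sg * (sg * (1 - l ^+ 2 * dot2 x x) / den x) = 2 / den x.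
  have -> : sg * (sg * (1 - l ^+ 2 * dot2 x x) / den x) =
    sg * sg * (1 - l ^+ 2 * dot2 x x) / den x by rewrite !mulrA.
  have -> : 1 - l ^+ 2 * dot2 x x = 2 - den x by rewrite /den; ring.
  by rewrite sg2; field.
case: x => a b /=; have := den_neq0 (a, b); move: (den _) => p p0.
by congr pair; field; rewrite p0 l1.
Qed.

(** The scalar product of stereo x with the pole sg *: north decreases with the norm
of x, so that disks correspond to caps. *)
Lemma stereographic_isometry (u : R * R -> R) :
  (forall x, disk r x -> expR (2 * u x) = (2 * l / (1 + l ^+ 2 * dot2 x x)) ^+ 2) ->
  isometric_to (disk r) u (geodesic_disk (sg *: north) (acos cap_cos)).
Proof.
move=> uE; exists stereo; split.
- by move=> k; apply: (Ck_on_sub (@subsetT _ _)); exact: stereo_smooth.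
- split.
  + move=> x xr; split; first exact: stereo_sphere.
    by rewrite acos_lt ?sphere_bound ?stereo_sphere// stereo_height height_disk.
  + by move=> x y _ _ e; rewrite -(stereoK x) e stereoK.
  + move=> q [qq]; rewrite acos_lt ?sphere_bound// => hq.
    have z1 : -1 < sg * q 0 i2.
      have /andP[c1 _] := cap_cos_bound; apply: (lt_trans c1).
      move: hq; rewrite dot3_expand !mxE /= !mulr0 !mul0r !add0r mulr1; exact.
    have e := stereo_invK qq z1; exists (stereo_inv q) => //.
    by rewrite /disk /= -height_disk -stereo_height e.
- by move=> x xr v w; rewrite stereo_conformal uE.
Qed.

End Stereographic.

Section ComplementaryCaps.
Context {R : realType}.

(** When l m r^2 = 1, inversion in the circle of radius r exchanges the two
projections, so the cosines of the two caps are opposite. *)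
Lemma complementary_stereographic (l m r : R) : 0 < l -> 0 < m -> 0 < r ->
  l * m * r ^+ 2 = 1 ->
  complementary_caps (geodesic_disk (1 *: north) (acos (cap_cos l r)))
                     (geodesic_disk ((-1) *: north) (acos (cap_cos m r))).
Proof.
move=> l0 m0 r0 lm; have lB := cap_cos_bound l0 r0; have /andP[l1 l2] := lB.
have E : cap_cos m r = - cap_cos l r.
  have r1 : r ^+ 2 != 0 by rewrite gt_eqF// exprn_gt0.
  have -> : m = (l * r ^+ 2)^-1.
    have lr0 : l * r ^+ 2 != 0 by rewrite mulf_neq0// gt_eqF.
    by apply: (mulIf lr0); rewrite mulVf//; rewrite -[RHS]lm; ring.
  have p0 : 1 + l ^+ 2 * r ^+ 2 != 0.
    by rewrite gt_eqF// addr_gt0// mulr_gt0// exprn_gt0.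
  by rewrite /cap_cos; field; rewrite exprMn p0 !gt_eqF.
exists north; exists (acos (cap_cos l r)); split.
- by rewrite /unit_sphere /= /dot3 !big_ord_recl big_ord0 !mxE/= !mulr0 mulr1 !add0r addr0.
- apply/andP; split; first by apply: acos_gt0; rewrite l2 ltW.
  by apply: acos_ltpi; rewrite l1 ltW.
- by rewrite scale1r.
- by rewrite scaleN1r E acosN// !ltW.
Qed.

Lemma stereographic_radial (u : R * R -> R) (r k sg : R) : radial u ->
  0 < r -> 0 < k -> sg * sg = 1 ->
  (forall s, 0 <= s < r -> expR (2 * ray0 u s) = 4 * k / (1 + k * s ^+ 2) ^+ 2) ->
  isometric_to (disk r) u (geodesic_disk (sg *: north) (acos (cap_cos (Num.sqrt k) r))).
Proof.
move=> ur r0 k0 sg2 uE; apply: stereographic_isometry => //; first by rewrite sqrtr_gt0.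
move=> x xr; rewrite (radialE ur); have d0 : 0 <= dot2 x x by rewrite addr_ge0// -expr2 sqr_ge0.
rewrite uE; last first.
  rewrite sqrtr_ge0/= -(gtr0_norm r0) -sqrtr_sqr ltr_sqrt//.
  by rewrite exprn_gt0.
rewrite sqr_sqrtr// expr_div_n exprMn sqr_sqrtr ?(ltW k0)//.
by congr (_ * _ / _); ring.
Qed.

End ComplementaryCaps.

(** * The covering inequality and its equality case *)

Section Covering.
Context {R : realType}.
Variables (u1 u2 : R * R -> R) (r C : R).
Hypotheses (u1_smooth : smooth_on setT u1) (u1_radial : radial u1).
Hypothesis u1_super : forall x, laplacian u1 x + expR (2 * u1 x) <= 0.
Hypotheses (u2_smooth : smooth_on setT u2) (u2_radial : radial u2) (r_gt0 : 0 < r).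
Hypothesis u2_ge : forall x, disk r x ->
  laplacian u2 x + expR (2 * u2 x) >= laplacian u1 x + expR (2 * u1 x).
Hypothesis u2_gt : forall x, disk r x -> u2 x > u1 x.
Hypothesis u2_eq : forall x, circle r x -> u2 x = u1 x.
Hypotheses (C_gt0 : 0 < C).
Hypothesis leb2_C : (@lebesgue_measure R \x @lebesgue_measure R)%E (disk 1) = C%:E.

Let f := ray0 u1. Let f1 := ray1 u1. Let f2 := ray2 u1.
Let g := ray0 u2. Let g1 := ray1 u2. Let g2 := ray2 u2.
Let mu := mass u1 C.
Let nu := mass u2 C.
Let Hf : profile f f1 f2 mu.
Proof. exact: (mass_profile u1_smooth u1_radial C_gt0 leb2_C). Qed.
Let Hg : profile g g1 g2 nu.
Proof. exact: (mass_profile u2_smooth u2_radial C_gt0 leb2_C). Qed.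

Let areaf (s : R) : area (disk s) u1 = (2 * C * mu s)%:E.
Proof. exact: (area_mass u1_smooth u1_radial C_gt0 leb2_C). Qed.
Let areag (s : R) : area (disk s) u2 = (2 * C * nu s)%:E.
Proof. exact: (area_mass u2_smooth u2_radial C_gt0 leb2_C). Qed.

Let df_le0 (s : R) : 0 < s -> defect f f1 f2 s <= 0.
Proof. by move=> s0; rewrite ray_defect// pmulr_rle0. Qed.

Let df_dg (s : R) : 0 < s < r -> defect f f1 f2 s <= defect g g1 g2 s.
Proof.
move=> /andP[s0 sr]; rewrite !ray_defect// ler_pM2l// u2_ge//.
by apply/disk_ray => //; exact: ltW.
Qed.

Let fg (s : R) : 0 <= s < r -> f s < g s.
Proof. by move=> /andP[s0 sr]; apply/u2_gt/disk_ray. Qed.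

Let fg_r : f r = g r.
Proof. by apply/esym/u2_eq; rewrite /circle/= /dot2/= mulr0 addr0 expr2. Qed.

Let excess := nu r ^+ 2 - 2 * (1 + r * f1 r) * nu r - r ^+ 2 * expR (2 * f r).

Let excess_ge0 : 0 <= excess.
Proof.
apply: (inner_bound Hf Hg r_gt0 _ df_dg fg fg_r) => s /andP[s0 _].
exact: df_le0.
Qed.

Let nu_gt0 : 0 < nu r. Proof. exact: (mass_gt0 Hg). Qed.

Let mu_lt_nu : mu r < nu r.
Proof. by apply: (mass_lt Hf Hg fg); rewrite r_gt0 lexx. Qed.

Let df_le0r (s : R) : r < s -> defect f f1 f2 s <= 0.
Proof. by move=> rs; apply: df_le0; exact: lt_trans rs. Qed.

Let sum_areas : (area (disk r) u1 + area (disk r) u2)%E = (2 * C * (mu r + nu r))%:E.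
Proof. by rewrite areaf areag -EFinD mulrDr. Qed.

Let plane_le (B : R) : (forall s, r <= s -> mu s <= B) -> (area setT u1 <= (2 * C * B)%:E)%E.
Proof.
move=> h; apply: area_plane_le => // s s0; rewrite areaf lee_fin ler_pM2l ?mulr_gt0//.
have [rs|sr] := leP r s; first exact: h.
apply: le_trans (h r (lexx r)); apply/ltW/(mass_incr Hf).
by rewrite sr ltW.
Qed.

Lemma covering_inequality : (area setT u1 <= area (disk r) u1 + area (disk r) u2)%E.
Proof.
rewrite sum_areas; apply: plane_le => s rs.
exact/ltW/(outer_bound Hf r_gt0 df_le0r nu_gt0 excess_ge0).
Qed.

Let disk_le_plane (s : R) : ((2 * C * mu s)%:E <= area setT u1)%E.
Proof. by rewrite -areaf; apply: area_sub => //; exact: measurable_disk. Qed.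

(** Inside and outside, the defect vanishes by the two rigidity lemmas; at the
radius r itself it is the derivative of the flux, which is constant nearby. *)
Lemma equality_rigidity :
  (area (disk r) u1 + area (disk r) u2 = area setT u1)%E ->
  (forall s, 0 < s -> defect f f1 f2 s = 0) /\
  (forall s, 0 < s < r -> defect g g1 g2 s = 0).
Proof.
rewrite sum_areas => eqA.
have sup_nu (e : R) : 0 < e -> exists2 s, r <= s & mu r + nu r - e < mu s.
  move=> e0; apply: contrapT => h.
  have : (area setT u1 <= (2 * C * (mu r + nu r - e))%:E)%E.
    apply: plane_le => s rs; rewrite leNgt; apply/negP => hs; apply: h.
    by exists s.
  rewrite -eqA lee_fin ler_pM2l ?mulr_gt0//.
  by rewrite lerDl oppr_ge0 leNgt e0.
have [E0 out0] := outer_rigidity Hf r_gt0 df_le0r nu_gt0 excess_ge0 sup_nu.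
have df_in s : 0 < s < r -> defect f f1 f2 s <= 0 by move=> /andP[/df_le0].
have in0 := inner_rigidity Hf Hg r_gt0 df_in df_dg fg fg_r E0.
split; last by move=> s /in0[].
move=> s s0; have [sr|rs|->] := ltgtP s r.
- by have [] := in0 s; rewrite ?s0.
- exact: out0.
- apply: (is_derive_near_cst (is_derive_flux r Hf) (c := r * f1 r + mu r)).
  have : \forall t \near r, 0 < t by exact: lt_nbhsr.
  apply: filterS => t t0; have [tr|rt] := leP t r.
    apply: (flux_constant Hf tr) => x /andP[tx xr].
    by have [] := in0 x; rewrite // xr (lt_trans t0).
  by apply/esym/(flux_constant Hf (ltW rt)) => x /andP[/out0].
Qed.

Lemma spherical_inside :
  (forall s, 0 < s < r -> defect f f1 f2 s = 0) ->
  (forall s, 0 < s < r -> defect g g1 g2 s = 0) -> mu r + nu r = 2.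
Proof.
move=> df0 dg0.
have rr : 0 <= r <= r by rewrite lexx ltW.
apply: (spherical_mass_sum mu_lt_nu (spherical_length Hf df0 rr)).
by rewrite -(spherical_length Hg dg0 rr) fg_r.
Qed.

(** The condition k m r^4 = 1 for the two parameters is mu r + nu r = 2 rewritten
with the explicit masses. *)
Lemma equality_isometric :
  (forall s, 0 < s < r -> defect f f1 f2 s = 0) ->
  (forall s, 0 < s < r -> defect g g1 g2 s = 0) ->
  isometric_to_complementary_caps (disk r) u1 u2.
Proof.
move=> df0 dg0; have xy := spherical_inside df0 dg0.
have [k k0 [mk uk]] := spherical_density Hf r_gt0 df0.
have [m m0 [nm um]] := spherical_density Hg r_gt0 dg0.
have r2 : 0 < r ^+ 2 by rewrite exprn_gt0.
have kr : 0 < k * r ^+ 2 by rewrite mulr_gt0.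
have mr : 0 < m * r ^+ 2 by rewrite mulr_gt0.
have km : (k * r ^+ 2) * (m * r ^+ 2) = 1.
  move: xy; rewrite mk nm; move: (k * r ^+ 2) (m * r ^+ 2) kr mr => p q p0 q0 h.
  have p1 : 1 + p != 0 by rewrite gt_eqF// addr_gt0.
  have q1 : 1 + q != 0 by rewrite gt_eqF// addr_gt0.
  have : 2 * (p * (1 + q) + q * (1 + p)) = 2 * ((1 + p) * (1 + q)).
    transitivity ((2 * p / (1 + p) + 2 * q / (1 + q)) * ((1 + p) * (1 + q))).
      by field; rewrite p1 q1.
    by rewrite h.
  lra.
exists (geodesic_disk (1 *: north) (acos (cap_cos (Num.sqrt k) r))).
exists (geodesic_disk ((-1) *: north) (acos (cap_cos (Num.sqrt m) r))); split.
- apply: complementary_stereographic; rewrite ?sqrtr_gt0//.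
  have -> : r ^+ 2 = Num.sqrt ((r ^+ 2) ^+ 2) by rewrite sqrtr_sqr gtr0_norm.
  rewrite -!sqrtrM ?mulr_ge0 ?(ltW k0) ?(ltW m0)//.
  have -> : k * m * (r ^+ 2) ^+ 2 = k * r ^+ 2 * (m * r ^+ 2) by ring.
  by rewrite km sqrtr1.
- by apply: (stereographic_radial u1_radial) => //; rewrite mulr1.
- by apply: (stereographic_radial u2_radial) => //; rewrite mulrNN mulr1.
Qed.

Lemma equality_of_spherical :
  (forall s, 0 < s -> defect f f1 f2 s = 0) ->
  (forall s, 0 < s < r -> defect g g1 g2 s = 0) ->
  (area (disk r) u1 + area (disk r) u2 = area setT u1)%E.
Proof.
move=> df0 dg0; apply/eqP; rewrite eq_le covering_inequality andbT sum_areas.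
rewrite (spherical_inside _ dg0); last by move=> s /andP[/df0].
apply/lee_addgt0Pr => e e0.
have C2 : 0 < 2 * C by rewrite mulr_gt0.
have [s rs ms] := spherical_mass_cvg Hf r_gt0 df0 (divr_gt0 e0 C2).
apply: le_trans (leeD2r e%:E (disk_le_plane s)); rewrite -EFinD lee_fin.
have : 2 * C * (2 - e / (2 * C)) < 2 * C * mu s by rewrite ltr_pM2l.
rewrite mulrBr (mulrC _ (e / _)) divfK ?gt_eqF// => h.
by rewrite -lerBlDr ltW.
Qed.

End Covering.

Lemma isometric_sphere_liouville (R : realType) (u : R * R -> R) (r : R) C :
  smooth_on setT u -> isometric_to (disk r) u C -> C `<=` unit_sphere ->
  forall x, disk r x -> laplacian u x + expR (2 * u x) = 0.
Proof.
move=> us [phi [phis [phiC _ _] metric]] CS x xr.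
apply: (theorema_egregium us (@open_disk R r) phis _ metric xr) => y yr.
by have := CS _ (phiC y yr).
Qed.

Theorem theorem1p9 (R : realType) (u1 u2 : R * R -> R) (r : R)
  (u1_smooth : smooth_on setT u1) (u1_radial : radial u1)
  (u1_super : forall x, laplacian u1 x + expR (2 * u1 x) <= 0)
  (u2_smooth : smooth_on setT u2) (u2_radial : radial u2)
  (r_gt0 : 0 < r)
  (u2_ge : forall x, disk r x ->
     laplacian u2 x + expR (2 * u2 x) >= laplacian u1 x + expR (2 * u1 x))
  (u2_gt : forall x, disk r x -> u2 x > u1 x)
  (u2_eq : forall x, circle r x -> u2 x = u1 x) :
  (area (disk r) u1 + area (disk r) u2 >= area setT u1)%E /\
  ((area (disk r) u1 + area (disk r) u2 = area setT u1)%E <->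
   isometric_to_complementary_caps (disk r) u1 u2 /\
   (forall x, ~ disk r x -> laplacian u1 x + expR (2 * u1 x) = 0)).
Proof.
have [C C_gt0 CE] := @leb2_disk1 R.
split.
  exact: (covering_inequality u1_smooth u1_radial u1_super u2_smooth u2_radial
    r_gt0 u2_ge u2_gt u2_eq C_gt0 CE).
split=> [eqA|[[C1 [C2 [caps iso1 iso2]]] out]].
- have [df0 dg0] := equality_rigidity u1_smooth u1_radial u1_super u2_smooth u2_radial
    r_gt0 u2_ge u2_gt u2_eq C_gt0 CE eqA.
  split.
    apply: (equality_isometric u1_smooth u1_radial u2_smooth u2_radial
      r_gt0 u2_gt u2_eq C_gt0 CE _ dg0) => s /andP[s0 _].
    exact: df0.
  move=> x xr; have d0 : 0 < dot2 x x.
    apply: (lt_le_trans (exprn_gt0 2 r_gt0)); rewrite leNgt; exact/negP.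
  have s0 : 0 < Num.sqrt (dot2 x x) by rewrite sqrtr_gt0.
  have := radial_defect u1_smooth u1_radial d0; rewrite (df0 _ s0) => /esym/eqP.
  by rewrite mulf_eq0 (gt_eqF s0) => /eqP.
- have [p [t [_ _ C1E C2E]]] := caps.
  have S1 : C1 `<=` unit_sphere by rewrite C1E => q [].
  have S2 : C2 `<=` unit_sphere by rewrite C2E => q [].
  apply: (equality_of_spherical u1_smooth u1_radial u1_super u2_smooth u2_radial
      r_gt0 u2_ge u2_gt u2_eq C_gt0 CE).
  + move=> s s0; rewrite ray_defect//.
    have [sr|rs] := ltP s r; last first.
      rewrite out ?mulr0// => /(disk_ray r_gt0 (ltW s0)).
      by rewrite ltNge rs.
    rewrite (isometric_sphere_liouville u1_smooth iso1 S1) ?mulr0//.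
    by apply/(disk_ray r_gt0 (ltW s0)).
  + move=> s /andP[s0 sr]; rewrite ray_defect//.
    rewrite (isometric_sphere_liouville u2_smooth iso2 S2) ?mulr0//.
    by apply/(disk_ray r_gt0 (ltW s0)).
Qed.
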